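(* Suppose $f\in F^2$ is not identically zero. Then $$\operatorname{dist}(f'-zf,[f])\,\operatorname{dist}(f'+zf,[f])\ge\|f\|^2,$$ where $[f]=\mathbb{C}f$ is the one-dimensional subspace of $F^2$ spanned by $f$. Furthermore, equality holds if and only if $$f(z)=C\exp\left(\frac{c-1}{2(c+1)}\,z^2+\frac{a+ibc}{c+1}\,z\right)$$ for some positive $c$, some real $a$ and $b$, and some nonzero complex $C$.
   Context: The Fock space is $F^2=L^2(\mathbb{C},d\lambda)\cap H(\mathbb{C})$, where $H(\mathbb{C})$ is the space of entire functions and $d\lambda(z)=\frac1\pi e^{-|z|^2}dA(z)$ with $dA$ ordinary area measure. It is a Hilbert space with $\langle f,g\rangle=\int_{\mathbb{C}} f\overline{g}\,d\lambda$ and $\|f\|^2=\int_{\mathbb{C}}|f|^2\,d\lambda$. Here $f'$ is the complex derivative, $zf$ denotes the function $z\mapsto zf(z)$, and $i$ is the imaginary unit. For an entire function $g$ not in $F^2$ we set $\|g\|=+\infty$. The distance is $\operatorname{dist}(g,[f])=\inf_{w\in\mathbb{C}}\|g-wf\|$. When $f'\notin F^2$ (equivalently $zf\notin F^2$) the left-hand side is regarded as $+\infty$, so the inequality is trivially true (and strict). *)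

(* Defs.v *)
From HB Require Import structures.
From mathcomp Require Import all_boot all_order all_algebra.
From mathcomp Require Import complex.
From mathcomp Require Import all_classical all_reals all_analysis.

Set Implicit Arguments.
Unset Strict Implicit.
Unset Printing Implicit Defensive.
Import Order.TTheory GRing.Theory Num.Theory.
Import numFieldNormedType.Exports.
Local Open Scope classical_set_scope.
Local Open Scope complex_scope.
Local Open Scope ring_scope.

(* The norm topology of the field R[i], as the library does for abstract fields. *)
#[export, non_forgetful_inheritance]
HB.instance Definition _ (R : rcfType) := GRing.ComAlgebra.copy R[i] R[i]^o.
#[export, non_forgetful_inheritance]
HB.instance Definition _ (R : rcfType) := Vector.copy R[i] R[i]^o.
#[export, non_forgetful_inheritance]
HB.instance Definition _ (R : rcfType) := NormedModule.copy R[i] R[i]^o.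

(* R[i] is a normed module over itself, so derivability along 1 is complex
   differentiability and derive1 f is the complex derivative. *)
Definition entire (R : realType) (f : R[i] -> R[i]) : Prop :=
  forall z : R[i], derivable f z 1.

Definition cexp (R : realType) (z : R[i]) : R[i] :=
  (expR (complex.Re z))%:C * (cos (complex.Im z) +i* sin (complex.Im z)).

(* The density of lambda with respect to the area measure dA. *)
Definition fock_density (R : realType) (z : R[i]) : R :=
  pi^-1 * expR (- Normc.normc z ^+ 2).

(* The squared norm is the integral of |g|^2 against lambda, with dA realised
   as the product Lebesgue measure on the plane via (x, y) |-> x + iy. It takes
   values in [0, +oo], and is +oo on entire functions that are not square
   integrable. *)
Definition fock_norm (R : realType) (g : R[i] -> R[i]) : \bar R :=
  sqrte (\int[(@lebesgue_measure R \x @lebesgue_measure R)%E]_p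
    (Normc.normc (g (p.1 +i* p.2)) ^+ 2 * fock_density (p.1 +i* p.2))%:E)%E.

Definition fock_space (R : realType) : set (R[i] -> R[i]) :=
  [set f | entire f /\ (fock_norm f < +oo)%E].

(* The distance from g to the line spanned by f. *)
Definition fock_dist (R : realType) (g f : R[i] -> R[i]) : \bar R :=
  ereal_inf [set fock_norm (fun z : R[i] => g z - w * f z) | w in [set: R[i]]].

(* dist(f' - zf, [f]) dist(f' + zf, [f]), understood as +oo when f' is not in
   the Fock space. *)
Definition dist_product (R : realType) (f : R[i] -> R[i]) : \bar R :=
  let dist_sub := fock_dist (fun z : R[i] => derive1 f z - z * f z) f in
  let dist_add := fock_dist (fun z : R[i] => derive1 f z + z * f z) f in
  if `[< fock_space (derive1 f) >] then (dist_sub * dist_add)%E else +oo%E.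

(* Main.v *)
Require Import Defs.
From HB Require Import structures.
From mathcomp Require Import all_boot all_order all_algebra.
From mathcomp Require Import complex.
From mathcomp Require Import all_classical all_reals all_analysis.
From mathcomp Require Import measurable_realfun ring lra.
Import Order.TTheory GRing.Theory Num.Theory.
Import numFieldNormedType.Exports.
Local Open Scope classical_set_scope.
Local Open Scope complex_scope.
Local Open Scope ring_scope.
Set Implicit Arguments.
Unset Strict Implicit.
Unset Printing Implicit Defensive.

(** The theorem is the uncertainty principle for the operators f |-> f' - z f
   and f |-> f' + z f. Multiplying f by the square root of the density gives a
   function F on the plane whose L^2 norm is the Fock norm of f. Let X and Z be
   the functions obtained in this way from f' - z f and f' + z f. The plane
   translations, twisted by suitable phases, are unitary operators W_v of L^2
   that satisfy the Weyl relation: W_u W_v and W_v W_u differ by a phase. The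
   derivatives of W_(s v) F at s = 0 are X for v = 1 and i Z for v = i. Hence, for
   the real part of the inner product,
     <X, F> = 0,   <i Z, F> = 0,   <X, Z> = - |F|^2;
   the first two identities express unitarity (generator_antisym) and the third
   one is the infinitesimal Weyl relation (commutator).

   Only F, X and Z are known to be square-integrable, so the third identity is
   not obtained by integrating by parts twice but by passing to the limit in an
   exact identity between difference quotients (dquot_commutator). The
   difference quotients converge pointwise, and as averages of W_s X or W_s (i Z)
   they have norms at most those of X and Z (generator_bound); by Fatou's lemma
   this suffices for their inner products to converge (ip_cvg).

   The multiple of F nearest to X is i b F and the one nearest to Z is a F, with
   a and b real. The residues X - i b F and Z - a F still have inner product
   - |F|^2, and the inequality is Cauchy-Schwarz (ip_le_min). Equality means that,
   almost everywhere and then everywhere by continuity, Z - a F is a multiple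
   - c (X - i b F), with c > 0 because the inner product is negative; that is
     (c + 1) f' = ((c - 1) z + a + i b c) f,
   and the solutions of this equation are the stated exponentials (linear_ode).
   Conversely, for such an f a gaussian bound shows that z f, and then f', is in
   the Fock space (gaussian_moment_L2), so that the same identities apply and
   Cauchy-Schwarz is an equality (min_le_ip).

   If f' is in the Fock space but z f is not, both distances are infinite. *)

(** * Complex numbers by real and imaginary parts *)

Section ComplexComponents.
Variable R : realType.
Implicit Types z w : R[i].

Lemma Re_add z w : complex.Re (z + w) = complex.Re z + complex.Re w.
Proof. by case: z w => [a b] [c d]. Qed.
Lemma Im_add z w : complex.Im (z + w) = complex.Im z + complex.Im w.
Proof. by case: z w => [a b] [c d]. Qed.
Lemma Re_opp z : complex.Re (- z) = - complex.Re z.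
Proof. by case: z. Qed.
Lemma Im_opp z : complex.Im (- z) = - complex.Im z.
Proof. by case: z. Qed.
Lemma Re_mul z w : complex.Re (z * w) =
  complex.Re z * complex.Re w - complex.Im z * complex.Im w.
Proof. by case: z w => [a b] [c d]. Qed.
Lemma Im_mul z w : complex.Im (z * w) =
  complex.Re z * complex.Im w + complex.Im z * complex.Re w.
Proof. by case: z w => [a b] [c d]. Qed.
Lemma Re_real (a : R) : complex.Re (a%:C) = a. Proof. by []. Qed.
Lemma Im_real (a : R) : complex.Im (a%:C) = 0. Proof. by []. Qed.
Lemma Re_mk (a b : R) : complex.Re (a +i* b) = a. Proof. by []. Qed.
Lemma Im_mk (a b : R) : complex.Im (a +i* b) = b. Proof. by []. Qed.
Lemma Re_1 : complex.Re (1 : R[i]) = 1. Proof. by []. Qed.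
Lemma Im_1 : complex.Im (1 : R[i]) = 0. Proof. by []. Qed.
Lemma Re_0 : complex.Re (0 : R[i]) = 0. Proof. by []. Qed.
Lemma Im_0 : complex.Im (0 : R[i]) = 0. Proof. by []. Qed.

Definition ci : R[i] := 0 +i* 1.

Lemma Re_ci : complex.Re ci = 0. Proof. by []. Qed.
Lemma Im_ci : complex.Im ci = 1. Proof. by []. Qed.

Definition ReImE := (Re_add, Im_add, Re_opp, Im_opp, Re_mul, Im_mul,
  Re_real, Im_real, Re_ci, Im_ci, Re_mk, Im_mk, Re_1, Im_1, Re_0, Im_0).

Lemma ciM z : ci * (ci * z) = - z.
Proof. by case: z => a b; rewrite /ci; simpc. Qed.

Lemma complex_ext z w :
  complex.Re z = complex.Re w -> complex.Im z = complex.Im w -> z = w.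
Proof. by case: z w => [a b] [c d] /= -> ->. Qed.

(** The real part of z times the conjugate of w. *)
Definition cdot z w : R :=
  complex.Re z * complex.Re w + complex.Im z * complex.Im w.

Lemma normc_sq z : Normc.normc z ^+ 2 = cdot z z.
Proof.
case: z => a b; rewrite /cdot /= sqr_sqrtr ?expr2//.
by rewrite addr_ge0// sqr_ge0.
Qed.

Lemma cdot_ge0 z : 0 <= cdot z z.
Proof. by rewrite -normc_sq sqr_ge0. Qed.

Lemma cdot_eq0 z : cdot z z = 0 -> z = 0.
Proof.
rewrite -normc_sq => /eqP; rewrite expf_eq0/= => /eqP.
exact: Normc.eq0_normc.
Qed.

Lemma normc_ge0 z : 0 <= Normc.normc z.
Proof. by case: z => a b /=; rewrite sqrtr_ge0. Qed.

Lemma Re_le_normc z : `|complex.Re z| <= Normc.normc z.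
Proof.
case: z => a b /=; rewrite -sqrtr_sqr ler_sqrt ?lerDl ?sqr_ge0//.
by rewrite addr_ge0 ?sqr_ge0.
Qed.

Lemma Im_le_normc z : `|complex.Im z| <= Normc.normc z.
Proof.
case: z => a b /=; rewrite -sqrtr_sqr ler_sqrt ?lerDr ?sqr_ge0//.
by rewrite addr_ge0 ?sqr_ge0.
Qed.

Lemma normc_le z : Normc.normc z <= `|complex.Re z| + `|complex.Im z|.
Proof.
case: z => a b /=; rewrite -[leRHS]ger0_norm ?addr_ge0// -sqrtr_sqr ler_sqrt.
  rewrite sqrrD !real_normK ?num_real// -addrA lerD2l lerDr.
  by rewrite mulrn_wge0// mulr_ge0.
by rewrite sqr_ge0.
Qed.

Lemma cexpD z w : cexp (z + w) = cexp z * cexp w.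
Proof.
rewrite /cexp !ReImE expRD cosD sinD; apply: complex_ext; rewrite !ReImE; ring.
Qed.

Lemma cexp0 : cexp (0 : R[i]) = 1.
Proof.
by rewrite /cexp !ReImE expR0 cos0 sin0; apply: complex_ext; rewrite !ReImE; ring.
Qed.

Lemma cexpNK z : cexp z * cexp (- z) = 1.
Proof. by rewrite -cexpD subrr cexp0. Qed.

Lemma cdotM z w : cdot (z * w) (z * w) = cdot z z * cdot w w.
Proof. rewrite /cdot !ReImE; ring. Qed.

Lemma cdot_cexp z : cdot (cexp z) (cexp z) = expR (2 * complex.Re z).
Proof.
rewrite cdotM (_ : 2 * _ = complex.Re z + complex.Re z); last by ring.
rewrite expRD /cdot !ReImE -!expr2 cos2Dsin2 mulr1; ring.
Qed.

End ComplexComponents.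

Arguments ci {R}.

(** * Complex-valued functions of a real variable *)

Section RealVariable.
Variable R : realType.
Implicit Types (g : R -> R[i]) (s : R) (d : R[i]).

Definition cderiv g s d :=
  is_derive s 1 (fun t => complex.Re (g t)) (complex.Re d) /\
  is_derive s 1 (fun t => complex.Im (g t)) (complex.Im d).

Lemma is_derive_add (a b : R -> R) s (a' b' : R) :
  is_derive s 1 a a' -> is_derive s 1 b b' ->
  is_derive s 1 (fun t => a t + b t) (a' + b').
Proof. exact: is_deriveD. Qed.

Lemma is_derive_sub (a b : R -> R) s (a' b' : R) :
  is_derive s 1 a a' -> is_derive s 1 b b' ->
  is_derive s 1 (fun t => a t - b t) (a' - b').
Proof. exact: is_deriveB. Qed.

Lemma is_derive_mul (a b : R -> R) s (a' b' : R) :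
  is_derive s 1 a a' -> is_derive s 1 b b' ->
  is_derive s 1 (fun t => a t * b t) (a s * b' + b s * a').
Proof. exact: is_deriveM. Qed.

Lemma cderiv_cst d0 s : cderiv (fun=> d0) s 0.
Proof. by split; exact: is_derive_cst. Qed.

Lemma cderiv_eq g s d d' : cderiv g s d -> d = d' -> cderiv g s d'.
Proof. by move=> ? <-. Qed.

Lemma cderivD g1 g2 s d1 d2 : cderiv g1 s d1 -> cderiv g2 s d2 ->
  cderiv (fun t => g1 t + g2 t) s (d1 + d2).
Proof.
move=> [a1 b1] [a2 b2]; split.
  under eq_fun do rewrite Re_add; rewrite Re_add; exact: is_derive_add.
under eq_fun do rewrite Im_add; rewrite Im_add; exact: is_derive_add.
Qed.

Lemma cderivM g1 g2 s d1 d2 : cderiv g1 s d1 -> cderiv g2 s d2 ->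
  cderiv (fun t => g1 t * g2 t) s (d1 * g2 s + g1 s * d2).
Proof.
move=> [a1 b1] [a2 b2]; split.
  under eq_fun do rewrite Re_mul.
  apply: is_derive_eq (is_derive_sub (is_derive_mul a1 a2) (is_derive_mul b1 b2)) _.
  by rewrite !ReImE; ring.
under eq_fun do rewrite Im_mul.
apply: is_derive_eq (is_derive_add (is_derive_mul a1 b2) (is_derive_mul b1 a2)) _.
by rewrite !ReImE; ring.
Qed.

Lemma cderiv_real (s : R) : cderiv (fun t => t%:C) s 1.
Proof. by split; [exact: is_derive_id|exact: is_derive_cst]. Qed.

Lemma cderivMl c g s d : cderiv g s d -> cderiv (fun t => c * g t) s (c * d).
Proof.
move=> h; apply: cderiv_eq (cderivM (cderiv_cst c s) h) _.
by rewrite mul0r add0r.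
Qed.

Lemma cderiv_cexp g s d : cderiv g s d ->
  cderiv (fun t => cexp (g t)) s (d * cexp (g s)).
Proof.
move=> [a b]; rewrite /cexp.
have h1 : cderiv (fun t => (expR (complex.Re (g t)))%:C) s
    (expR (complex.Re (g s)) * complex.Re d)%:C.
  split; last exact: (is_derive_cst (0 : R)).
  exact: (is_derive1_comp (is_derive_expR _) a).
have [x xE] : exists x, x = - (sin (complex.Im (g s)) * complex.Im d) by eexists.
have [y yE] : exists y, y = cos (complex.Im (g s)) * complex.Im d by eexists.
have h2 : cderiv (fun t => cos (complex.Im (g t)) +i* sin (complex.Im (g t))) s
    (x +i* y).
  split.
    apply: is_derive_eq (is_derive1_comp (is_derive_cos _) b) _.
    by rewrite ReImE xE mulNr.
  apply: is_derive_eq (is_derive1_comp (is_derive_sin _) b) _.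
  by rewrite ReImE yE.
apply: cderiv_eq (cderivM h1 h2) _.
by apply: complex_ext; rewrite !ReImE xE yE; ring.
Qed.

Lemma cderiv_unique g s d d' : cderiv g s d -> cderiv g s d' -> d = d'.
Proof.
move=> [a b] [a' b']; apply: complex_ext.
  by rewrite -(derive_val (is_derive := a)) -(derive_val (is_derive := a')).
by rewrite -(derive_val (is_derive := b)) -(derive_val (is_derive := b')).
Qed.

Lemma cderiv_cdot c g s d : cderiv g s d ->
  is_derive s 1 (fun t => cdot c (g t)) (cdot c d).
Proof.
move=> [a b]; apply: is_derive_eq (is_derive_add
  (is_derive_mul (is_derive_cst _ _ _) a) (is_derive_mul (is_derive_cst _ _ _) b)) _.
by rewrite /cdot; ring.
Qed.

Lemma cderiv_continuous g s d : cderiv g s d ->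
  {for s, continuous (fun t => complex.Re (g t))} /\
  {for s, continuous (fun t => complex.Im (g t))}.
Proof.
move=> [a b]; split; apply: differentiable_continuous; apply/derivable1_diffP;
  exact: ex_derive.
Qed.

Lemma cderiv0_cst g (a b : R) : (forall t, cderiv g t 0) -> g a = g b.
Proof.
move=> h; apply: complex_ext.
  apply: (@is_derive_0_is_cst _ (fun t => complex.Re (g t))) => t.
  by case: (h t).
apply: (@is_derive_0_is_cst _ (fun t => complex.Im (g t))) => t.
by case: (h t).
Qed.

End RealVariable.

(** * Entire functions along lines *)

Section EntireFunctions.
Variable R : realType.
Implicit Types (f : R[i] -> R[i]) (z v : R[i]).

Lemma norm_normc z : `|z| = (Normc.normc z)%:C.
Proof. by case: z. Qed.

(** The complex derivative in terms of real moduli: real differentiability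
   along lines and continuity are both read off from this estimate. *)
Lemma entire_quotient f z (e : R) : entire f -> 0 < e ->
  exists2 r : R, 0 < r & forall h : R[i], h != 0 -> Normc.normc h < r ->
    Normc.normc (h^-1 * (f (z + h) - f z) - derive1 f z) < e.
Proof.
move=> ef e0; have dz := ef z.
have : (fun h : R[i] => h^-1 *: (f (h + z) - f z)) @ 0^' --> derive1 f z.
  rewrite /derive1.
  have <- : (fun h : R[i] => h^-1 *: (f (h *: (1 : R[i]) + z) - f z)) =
            (fun h : R[i] => h^-1 *: (f (h + z) - f z)).
    by apply/funext => h; rewrite /GRing.scale/= mulr1.
  exact: dz.
move/cvgrPdist_lt => /(_ e%:C); rewrite ltcR => /(_ e0).
rewrite near_withinE => /nbhs_normP[[r r']/= ].
rewrite ltcE/= => /andP[/eqP r'0 r0] H; exists r => // h h0 hr.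
rewrite -ltcR.
have /H/(_ h0) : ball_ Num.norm 0 (r +i* r') h.
  rewrite r'0; change (`|0 - h| < r%:C); rewrite sub0r normrN.
  by rewrite norm_normc ltcR.
by rewrite distrC norm_normc [h + z]addrC.
Qed.

Lemma cderiv_line f z v (s : R) : entire f ->
  cderiv (fun t : R => f (z + t%:C * v)) s (v * derive1 f (z + s%:C * v)).
Proof.
move=> ef.
have [->|v0] := eqVneq v 0.
  rewrite mul0r; under eq_fun do rewrite mulr0 addr0; exact: cderiv_cst.
have nv0 : 0 < Normc.normc v.
  rewrite lt_neqAle normc_ge0 andbT eq_sym; apply: contra v0 => /eqP.
  by move/Normc.eq0_normc => ->.
set w := z + s%:C * v.
have key e : 0 < e -> \forall h \near 0^',
    Normc.normc (((h : R)%:C)^-1 * (f (z + (h + s)%:C * v) - f w) - v * derive1 f w) < e.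
  move=> e0.
  have [r r0 H] := entire_quotient w ef (divr_gt0 e0 nv0).
  rewrite near_withinE; apply/nbhs_normP; exists (r / Normc.normc v) => /=.
    by rewrite divr_gt0.
  move=> h; rewrite /ball_/= sub0r normrN => hr h0.
  have hC0 : h%:C != 0 :> R[i] by rewrite -(inj_eq (@complexI R))/= in h0 *.
  have hv0 : h%:C * v != 0 by rewrite mulf_neq0.
  have : Normc.normc (h%:C * v) < r.
    rewrite Normc.normcM/= expr0n/= addr0 sqrtr_sqr.
    by rewrite -ltr_pdivlMr.
  move/(H _ hv0); rewrite ltr_pdivlMr// -Normc.normcM.
  congr (Normc.normc _ < e); rewrite /w.
  rewrite (_ : z + (h + s)%:C * v = z + s%:C * v + h%:C * v); last first.
    by rewrite rmorphD/=; ring.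
  by field; rewrite v0 hC0.
(* Both parts are real-linear maps dominated by the modulus. *)
have cv (P : R[i] -> R) :
  (forall a b, P (a - b) = P a - P b) -> (forall (x : R) a, P ((x%:C)^-1 * a) = x^-1 * P a) ->
  (forall a, `|P a| <= Normc.normc a) ->
  is_derive s 1 (fun t => P (f (z + t%:C * v))) (P (v * derive1 f w)).
  move=> PB PZ Pn.
  suff H : (fun h : R => h^-1 *: (P (f (z + (h *: (1:R) + s)%:C * v)) - P (f w))) @ 0^'
      --> P (v * derive1 f w).
    apply: DeriveDef; first exact: (cvgP _ H).
    exact: (cvg_lim _ H).
  apply/cvgrPdist_lt => e e0; have := key e e0; apply: filterS => h.
  apply: le_lt_trans; rewrite /GRing.scale/= mulr1 -PB -PZ distrC -PB.
  exact: Pn.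
split; apply: cv.
- by move=> a b; rewrite !ReImE.
- by move=> x a; rewrite -fmorphV/= !ReImE mul0r subr0.
- exact: Re_le_normc.
- by move=> a b; rewrite !ReImE.
- by move=> x a; rewrite -fmorphV/= !ReImE mul0r addr0.
- exact: Im_le_normc.
Qed.

Lemma entire_near f z (e : R) : entire f -> 0 < e ->
  exists2 r : R, 0 < r & forall w, Normc.normc (w - z) < r ->
    Normc.normc (f w - f z) < e.
Proof.
move=> ef e0; have [r r0 H] := entire_quotient z ef ltr01.
pose M := 1 + Normc.normc (derive1 f z).
have M0 : 0 < M by rewrite ltr_pwDl// normc_ge0.
exists (Num.min r (e / M)); first by rewrite lt_min r0 divr_gt0.
move=> w; rewrite lt_min => /andP[wr we].
have [->|wz] := eqVneq w z.
  by rewrite subrr Normc.normc0.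
have h0 : w - z != 0 by rewrite subr_eq0.
have := H _ h0 wr; rewrite [z + _]addrC subrK => q.
have -> : f w - f z = (w - z) * ((w - z)^-1 * (f w - f z) - derive1 f z + derive1 f z).
  by field.
rewrite Normc.normcM (le_lt_trans (y := Normc.normc (w - z) * M))//.
  rewrite ler_wpM2l ?normc_ge0//.
  apply: (le_trans (le_normcD (_ : Rcomplex R) (_ : Rcomplex R))).
  by rewrite lerD2r ltW.
by rewrite -ltr_pdivlMr.
Qed.

Lemma entireM f g : entire f -> entire g -> entire (fun z => f z * g z).
Proof. by move=> ef eg z; exact: derivableM (ef z) (eg z). Qed.

Lemma entireD f g : entire f -> entire g -> entire (fun z => f z + g z).
Proof. by move=> ef eg z; exact: derivableD (ef z) (eg z). Qed.

Lemma entireB f g : entire f -> entire g -> entire (fun z => f z - g z).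
Proof. by move=> ef eg z; exact: derivableB (ef z) (eg z). Qed.

Lemma entire_cst (c : R[i]) : entire (fun=> c).
Proof. by move=> z; exact: derivable_cst. Qed.

Lemma entire_id : entire (fun z : R[i] => z).
Proof. by move=> z; exact: derivable_id. Qed.

End EntireFunctions.

(** * Lebesgue measure on the plane *)

Section Plane.
Variable R : realType.
Local Notation line := (measurableTypeR R).
Local Notation plane := (line * line)%type.
Local Notation mu := (@lebesgue_measure R).
Local Notation mu2 := (mu \x mu)%E.

Lemma measurable_shift (a : R) : measurable_fun [set: line] (fun x : line => (x + a : line)).
Proof. exact: measurable_funD. Qed.

Lemma integral_shift (G : line -> \bar R) (a : R) : measurable_fun setT G ->
  (forall x, 0 <= G x)%E -> (\int[mu]_x G (x + a)%R = \int[mu]_x G x)%E.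
Proof.
move=> mG G0; pose phi : line -> line := fun x => x + a.
have mphi : measurable_fun setT phi := measurable_shift a.
transitivity (\int[mu]_(x in phi @^-1` setT) (G \o phi) x)%E; first by [].
rewrite -ge0_integral_pushforward//; apply: eq_measure_integral => /= A mA _.
apply/esym/lebesgue_measure_unique => //= _ [[u v]] _ <-.
rewrite /pushforward.
have -> : phi @^-1` `]u, v] = `]u - a, v - a]%classic.
  apply/seteqP; split => x /=; rewrite !in_itv/= /phi => /andP[h1 h2];
   by apply/andP; split; lra.
rewrite !lebesgue_measure_itv/= !lte_fin ltrD2r; case: ifP => // _.
by rewrite -!EFinB; congr EFin; ring.
Qed.

Lemma measurable_shift2 (a b : R) :
  measurable_fun [set: plane] (fun p : plane => (p.1 + a, p.2 + b) : plane).
Proof.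
apply/measurable_fun_pairP; split => /=.
  exact: (measurableT_comp (measurable_shift a) (measurable_fst)).
exact: (measurableT_comp (measurable_shift b) (measurable_snd)).
Qed.

Lemma integral_shift2 (G : plane -> \bar R) (a b : R) : measurable_fun setT G ->
  (forall p, 0 <= G p)%E ->
  (\int[mu2]_p G (p.1 + a, p.2 + b)%R = \int[mu2]_p G p)%E.
Proof.
move=> mG G0.
have mG' : measurable_fun setT (fun p : plane => G (p.1 + a, p.2 + b)).
  exact: (measurableT_comp mG (measurable_shift2 a b)).
rewrite (fubini_tonelli1 (m1 := mu) (m2 := mu) _ mG')//.
rewrite (fubini_tonelli1 (m1 := mu) (m2 := mu) _ mG)//.
rewrite /fubini_F/=.
rewrite -(integral_shift a (measurable_fun_fubini_tonelli_F (m2 := mu) _ mG G0)); last first.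
  by move=> x; exact: integral_ge0.
apply: eq_integral => x _; rewrite /fubini_F/=.
apply: (integral_shift b (G := fun y => G (x + a, y))) => //.
exact: measurable_fun_pair2.
Qed.

(** Continuity for the product topology, stated by distances on the type of the
   plane that carries the product sigma-algebra. *)
Definition continuous2 (h : plane -> R) := forall p (e : R), 0 < e ->
  exists2 r : R, 0 < r & forall q : plane,
    `|q.1 - p.1| < r -> `|q.2 - p.2| < r -> `|h q - h p| < e.

(** An open set of the plane is the union of the countably many squares with
   rational centres and inverse-integer sizes that it contains. *)
Lemma continuous2_measurable (h : plane -> R) : continuous2 h ->
  measurable_fun setT h.
Proof.
move=> ch mD; apply: (measurability _ (RGenOInfty.measurableE R)) => //.
move=> /= _ [_ [a ->] <-]; rewrite setTI.
set O := h @^-1` _.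
pose box (i : rat * rat * nat) : set plane :=
  (ball (ratr i.1.1 : R) i.2.+1%:R^-1) `*` (ball (ratr i.1.2 : R) i.2.+1%:R^-1).
pose F i := if `[< box i `<=` O >] then box i else set0.
have mF i : measurable (F i).
  rewrite /F; case: ifP => _; last exact: measurable0.
  by apply: measurableX; exact: measurable_ball.
suff -> : O = \bigcup_i F i by exact: countable_bigcupT_measurable.
apply/seteqP; split => [p Op|p [i _]]; last first.
  by rewrite /F; case: ifPn => // /asboolP; apply.
have : a < h p by move: Op; rewrite /O/= in_itv/= andbT.
rewrite -subr_gt0 => /(ch p)[r r0 hr].
have [n nr] : exists n : nat, n.+1%:R^-1 < r / 2.
  have [n _ H] := near_infty_natSinv_lt (PosNum (divr_gt0 r0 (ltr0Sn R 1))).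
  by exists n; apply: H => /=.
have n0 : 0 < n.+1%:R^-1 :> R by rewrite invr_gt0.
have cl (x : R) : exists q : rat, ball (ratr q : R) n.+1%:R^-1 x.
  have [q] := @rat_in_itvoo R (x - n.+1%:R^-1) (x + n.+1%:R^-1)
    ltac:(by rewrite ltrD2l gtrN).
  rewrite in_itv/= => /andP[q1 q2]; exists q; rewrite /ball/= ltr_distl.
  by rewrite q1 q2.
have [q1 hq1] := cl p.1; have [q2 hq2] := cl p.2.
exists (q1, q2, n) => //; rewrite /F asboolT; first by split.
move=> w [/= w1 w2].
have far (q x y : R) : ball q n.+1%:R^-1 x -> ball q n.+1%:R^-1 y -> `|y - x| < r.
  rewrite /ball/= => hx hy; have -> : y - x = (q - x) - (q - y) by ring.
  apply: (lt_trans (le_lt_trans (ler_normB _ _) (ltrD hx hy))).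
  by rewrite [ltRHS]splitr ltrD.
have := hr w (far _ _ _ hq1 w1) (far _ _ _ hq2 w2).
rewrite /O/= in_itv/= andbT ltr_distl => /andP[H _]; lra.
Qed.

(** A nonzero value would persist on a square, which has positive area. *)
Lemma continuous2_ae0 (h : plane -> R) : continuous2 h -> (forall p, 0 <= h p) ->
  (\int[mu2]_p (h p)%:E = 0)%E -> forall p, h p = 0.
Proof.
move=> ch h0 I0 p; apply/eqP; apply: contraT => hp0.
have hp : 0 < h p by rewrite lt_neqAle eq_sym hp0 h0.
have [r r0 hr] := ch p (h p / 2) (divr_gt0 hp (ltr0Sn R 1)).
pose Q : set plane := ball (p.1 : R) r `*` ball (p.2 : R) r.
have mQ : measurable Q by apply: measurableX; exact: measurable_ball.
have mh := continuous2_measurable ch.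
have : ((h p / 2)%:E * mu2 Q <= 0)%E.
  rewrite -(integral_cst mu2 mQ) -[leRHS]I0; apply: (@le_trans _ _ (\int[mu2]_(q in Q) (h q)%:E)%E).
    apply: ge0_le_integral => //.
    - by move=> q _; rewrite lee_fin divr_ge0 ?h0.
    - by apply/measurable_EFinP; exact: measurable_funTS.
    - move=> q [+ +]; rewrite lee_fin /ball/= ![`|p.1 - _|]distrC ![`|p.2 - _|]distrC.
      by move=> q1 q2; have := hr q q1 q2; rewrite ltr_distl => /andP[H _]; lra.
  apply: ge0_subset_integral => //.
    by apply/measurable_EFinP.
  by move=> q _; rewrite lee_fin.
have area : (mu2 Q = (r *+ 2)%:E * (r *+ 2)%:E)%E.
  transitivity (mu (ball p.1 r) * mu (ball p.2 r))%E.
    by apply: product_measure1E; exact: measurable_ball.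
  by rewrite !lebesgue_measure_ball ?ltW.
rewrite area -!EFinM lee_fin.
have : 0 < h p / 2 * (r *+ 2 * (r *+ 2)) by rewrite !mulr_gt0// ?mulrn_wgt0// invr_gt0.
by move=> H1 H2; have := lt_le_trans H1 H2; rewrite ltxx.
Qed.

End Plane.

Section ThreeVariables.
Context d1 d2 d3 (T1 : measurableType d1) (T2 : measurableType d2)
  (T3 : measurableType d3) (R : realType).
Variables (m1 : {sigma_finite_measure set T1 -> \bar R})
  (m2 : {sigma_finite_measure set T2 -> \bar R})
  (m3 : {sigma_finite_measure set T3 -> \bar R}).

(** Tonelli's theorem for a product measure against a third one, by exchanging
   the third variable with each of the first two in turn. *)
Lemma tonelli_prod (K : T1 * T2 * T3 -> \bar R) :
  measurable_fun setT K -> (forall q, 0 <= K q)%E ->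
  (\int[m1 \x m2]_p \int[m3]_s K (p, s) = \int[m3]_s \int[m1 \x m2]_p K (p, s))%E.
Proof.
move=> mK K0.
have mG := measurable_fun_fubini_tonelli_F (m2 := m3) K mK K0.
have m12 x : measurable_fun setT (fun q : T2 * T3 => K (x, q.1, q.2)).
  apply: (measurableT_comp mK); apply/measurable_fun_pairP; split => /=.
    apply/measurable_fun_pairP; split => /=; first exact: measurable_cst.
    exact: measurable_fst.
  exact: measurable_snd.
have m132 : measurable_fun setT (fun q : T1 * T3 * T2 => K (q.1.1, q.2, q.1.2)).
  apply: (measurableT_comp mK); apply/measurable_fun_pairP; split => /=.
    apply/measurable_fun_pairP; split => /=; last exact: measurable_snd.
    exact: (measurableT_comp measurable_fst measurable_fst).
  exact: (measurableT_comp measurable_snd measurable_fst).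
have mH := measurable_fun_fubini_tonelli_F (m2 := m2) _ m132 (fun q => K0 _).
transitivity (\int[m1]_x \int[m2]_y \int[m3]_s K ((x, y), s))%E.
  rewrite (fubini_tonelli1 (m1 := m1) (m2 := m2) _ mG)// => p.
  exact: integral_ge0.
transitivity (\int[m1]_x \int[m3]_s \int[m2]_y K ((x, y), s))%E.
  by apply: eq_integral => x _; apply: (fubini_tonelli (m1 := m2) (m2 := m3) _ (m12 x)).
transitivity (\int[m3]_s \int[m1]_x \int[m2]_y K ((x, y), s))%E.
  apply: (fubini_tonelli (m1 := m1) (m2 := m3) _ mH) => q.
  by apply: integral_ge0 => y _; exact: K0.
apply: eq_integral => s _; apply/esym.
apply: (fubini_tonelli1 (m1 := m1) (m2 := m2) (fun p => K (p, s))) => //.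
exact: measurable_fun_pair1.
Qed.

End ThreeVariables.

(** * Square-integrable complex functions *)

Section SquareIntegrable.
Context d (T : measurableType d) (R : realType) (mu : {measure set T -> \bar R}).
Implicit Types (u v w : T -> R[i]) (c : R[i]).

Definition cmeasurable u :=
  measurable_fun setT (fun x => complex.Re (u x)) /\
  measurable_fun setT (fun x => complex.Im (u x)).

Definition sqnorm u : \bar R := (\int[mu]_x (cdot (u x) (u x))%:E)%E.

Definition L2 u := cmeasurable u /\ (sqnorm u < +oo)%E.

(** The real part of the hermitian inner product. The imaginary part of the
   product of u and v is recovered as ip u (i v). *)
Definition ip u v : R := (\int[mu]_x (cdot (u x) (v x)))%R.

Lemma cmeasurableD u v : cmeasurable u -> cmeasurable v ->
  cmeasurable (fun x => u x + v x).
Proof.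
move=> [a b] [a' b']; split.
  under eq_fun do rewrite Re_add; exact: measurable_funD.
under eq_fun do rewrite Im_add; exact: measurable_funD.
Qed.

Lemma cmeasurableM u v : cmeasurable u -> cmeasurable v ->
  cmeasurable (fun x => u x * v x).
Proof.
move=> [a b] [a' b']; split.
  under eq_fun do rewrite Re_mul.
  by apply: measurable_funB; exact: measurable_funM.
under eq_fun do rewrite Im_mul.
by apply: measurable_funD; exact: measurable_funM.
Qed.

Lemma cmeasurable_cst c : cmeasurable (fun=> c).
Proof. by split; exact: measurable_cst. Qed.

Lemma measurable_cdot u v : cmeasurable u -> cmeasurable v ->
  measurable_fun setT (fun x => cdot (u x) (v x)).
Proof.
move=> [a b] [a' b']; rewrite /cdot.
by apply: measurable_funD; exact: measurable_funM.
Qed.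

Lemma sqnorm_ge0 u : (0 <= sqnorm u)%E.
Proof. by apply: integral_ge0 => x _; rewrite lee_fin cdot_ge0. Qed.

Lemma integrable_sq u : L2 u -> mu.-integrable setT (EFin \o (fun x => cdot (u x) (u x))).
Proof.
move=> [mu_ fu]; apply/integrableP; split.
  by apply/measurable_EFinP; exact: measurable_cdot.
apply: le_lt_trans fu; rewrite /sqnorm le_eqVlt; apply/orP; left; apply/eqP.
by apply: eq_integral => x _ /=; rewrite ger0_norm ?cdot_ge0.
Qed.

Lemma integrable_cdot u v : L2 u -> L2 v ->
  mu.-integrable setT (EFin \o (fun x => cdot (u x) (v x))).
Proof.
move=> hu hv.
have iuv := integrableD measurableT (integrable_sq hu) (integrable_sq hv).
apply: le_integrable iuv => //.
  by apply/measurable_EFinP; apply: measurable_cdot; [case: hu|case: hv].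
move=> x _ /=; rewrite lee_fin [leRHS]ger0_norm; last by apply: addr_ge0; exact: cdot_ge0.
rewrite ler_norml /cdot.
move: (complex.Re (u x)) (complex.Im (u x)) (complex.Re (v x)) (complex.Im (v x)).
move=> a b a' b'; apply/andP; split.
  have := sqr_ge0 (a + a'); have := sqr_ge0 (b + b').
  have := sqr_ge0 a; have := sqr_ge0 a'; have := sqr_ge0 b; have := sqr_ge0 b'.
  rewrite !expr2; nra.
have := sqr_ge0 (a - a'); have := sqr_ge0 (b - b').
have := sqr_ge0 a; have := sqr_ge0 a'; have := sqr_ge0 b; have := sqr_ge0 b'.
rewrite !expr2; nra.
Qed.

Lemma sqnormE u : L2 u -> sqnorm u = (ip u u)%:E.
Proof.
move=> hu; rewrite /ip /Rintegral fineK//.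
exact: integrable_fin_num (integrable_sq hu).
Qed.

Lemma L2D u v : L2 u -> L2 v -> L2 (fun x => u x + v x).
Proof.
move=> hu hv; have mD := cmeasurableD hu.1 hv.1; split => //.
have i4 : mu.-integrable setT (EFin \o (fun x => (2 * cdot (u x) (u x) + 2 * cdot (v x) (v x))%R)).
  apply: (integrableD measurableT (f := fun x => (2 * cdot (u x) (u x))%:E)
    (g := fun x => (2 * cdot (v x) (v x))%:E)).
    by apply: (integrableZl measurableT 2 (integrable_sq hu)).
  by apply: (integrableZl measurableT 2 (integrable_sq hv)).
case/integrableP: i4 => _; apply: le_lt_trans; apply: ge0_le_integral => //=.
- by move=> x _; rewrite lee_fin cdot_ge0.
- by apply/measurable_EFinP; exact: measurable_cdot.
- apply/measurable_EFinP/measurableT_comp => //.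
  apply: measurable_funD; apply: measurable_funM; try exact: measurable_cst.
    by apply: measurable_cdot; case: hu.
  by apply: measurable_cdot; case: hv.
move=> x _; rewrite lee_fin; apply: le_trans (ler_norm _).
rewrite /cdot !ReImE.
move: (complex.Re (u x)) (complex.Im (u x)) (complex.Re (v x)) (complex.Im (v x)).
move=> a b a' b'.
have := sqr_ge0 (a - a'); have := sqr_ge0 (b - b'); rewrite !expr2; nra.
Qed.

Lemma sqnormZ c u : cmeasurable u ->
  sqnorm (fun x => c * u x) = ((cdot c c)%:E * sqnorm u)%E.
Proof.
move=> hu; rewrite /sqnorm -ge0_integralZl//.
- by apply: eq_integral => x _; rewrite cdotM EFinM.
- by apply/measurable_EFinP; exact: measurable_cdot.
- by move=> x _; rewrite lee_fin cdot_ge0.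
- by rewrite lee_fin cdot_ge0.
Qed.

Lemma L2Z c u : L2 u -> L2 (fun x => c * u x).
Proof.
move=> hu; split; first exact: cmeasurableM (cmeasurable_cst c) hu.1.
by rewrite sqnormZ ?(sqnormE hu); [rewrite -EFinM ltry | case: hu].
Qed.

Lemma L2B u v : L2 u -> L2 v -> L2 (fun x => u x - v x).
Proof.
move=> hu hv; have -> : (fun x => u x - v x) = (fun x => u x + (-1) * v x).
  by apply/funext => x; rewrite mulN1r.
exact: L2D (L2Z _ hv).
Qed.

Lemma ip_ge0 u : 0 <= ip u u.
Proof. by apply: Rintegral_ge0 => x _; exact: cdot_ge0. Qed.

Lemma ipC u v : ip u v = ip v u.
Proof. by congr Rintegral; apply/funext => x; rewrite /cdot; ring. Qed.

Lemma ipDl u v w : L2 u -> L2 v -> L2 w ->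
  ip (fun x => u x + v x) w = ip u w + ip v w.
Proof.
move=> hu hv hw; rewrite -RintegralD//; try exact: integrable_cdot.
by congr Rintegral; apply/funext => x; rewrite /cdot !ReImE; ring.
Qed.

Lemma ipZl (r : R) u w : L2 u -> L2 w ->
  ip (fun x => r%:C * u x) w = r * ip u w.
Proof.
move=> hu hw; rewrite -RintegralZl//; last exact: integrable_cdot.
by congr Rintegral; apply/funext => x; rewrite /cdot !ReImE; ring.
Qed.

Lemma ipDr u v w : L2 u -> L2 v -> L2 w ->
  ip w (fun x => u x + v x) = ip w u + ip w v.
Proof. by move=> *; rewrite ipC ipDl// ![ip w _]ipC. Qed.

Lemma ipZr (r : R) u w : L2 u -> L2 w ->
  ip w (fun x => r%:C * u x) = r * ip w u.
Proof. by move=> *; rewrite ipC ipZl// ipC. Qed.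

Lemma ipNl u w : L2 u -> L2 w -> ip (fun x => - u x) w = - ip u w.
Proof.
move=> hu hw; rewrite -mulN1r -ipZl//; congr ip; apply/funext => x.
by rewrite rmorphN1 mulN1r.
Qed.

Lemma ipNr u w : L2 u -> L2 w -> ip w (fun x => - u x) = - ip w u.
Proof. by move=> *; rewrite ipC ipNl// ipC. Qed.

Lemma ipNN u : ip (fun x => - u x) (fun x => - u x) = ip u u.
Proof. by congr Rintegral; apply/funext => x; rewrite /cdot !ReImE; ring. Qed.

Lemma ipBl u v w : L2 u -> L2 v -> L2 w ->
  ip (fun x => u x - v x) w = ip u w - ip v w.
Proof.
move=> hu hv hw; rewrite -RintegralB//; try exact: integrable_cdot.
by congr Rintegral; apply/funext => x; rewrite /cdot !ReImE; ring.
Qed.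

Lemma ipBr u v w : L2 u -> L2 v -> L2 w ->
  ip w (fun x => u x - v x) = ip w u - ip w v.
Proof. by move=> *; rewrite ipC ipBl// ![ip w _]ipC. Qed.

Lemma ip_rotl u w : L2 u -> L2 w ->
  ip (fun x => ci * u x) w = - ip u (fun x => ci * w x).
Proof.
move=> hu hw; rewrite -ipNr//; last exact: L2Z.
by congr Rintegral; apply/funext => x; rewrite /cdot !ReImE; ring.
Qed.

Lemma ip_rot u v : ip (fun x => ci * u x) (fun x => ci * v x) = ip u v.
Proof. by congr Rintegral; apply/funext => x; rewrite /cdot !ReImE; ring. Qed.

Lemma ip_rot_self u : ip u (fun x => ci * u x) = 0.
Proof.
rewrite /ip (_ : (fun _ => _) = fun=> 0) ?Rintegral_cst ?mul0r//.
by apply/funext => x; rewrite /cdot !ReImE; ring.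
Qed.

Lemma fatou_eventually (g : nat -> T -> R) (G : T -> R) (x e : R) :
  (forall n, measurable_fun setT (g n)) -> (forall n t, 0 <= g n t) ->
  (forall t, (fun n => g n t) @ \oo --> G t) ->
  (\int[mu]_t (G t)%:E = x%:E)%E -> 0 < e ->
  \forall n \near \oo, ((x - e)%:E < \int[mu]_t (g n t)%:E)%E.
Proof.
move=> mg g0 gG Gx e0.
have mg' n : measurable_fun setT (fun t => (g n t)%:E).
  by apply/measurable_EFinP; exact: mg.
have g0' n t : setT t -> (0 <= (g n t)%:E)%E by rewrite lee_fin.
have := @fatou _ T R mu setT measurableT (fun n t => (g n t)%:E) mg' g0'.
have -> : (\int[mu]_t limn_einf (fun n => (g n t)%:E) = x%:E)%E.
  rewrite -Gx; apply: eq_integral => t _.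
  have c : (fun n => (g n t)%:E) @ \oo --> (G t)%:E.
    by apply/fine_cvgP; split; [exact: nearW|exact: gG].
  by have [-> _] := cvg_limn_einf_sup c.
rewrite limn_einf_lim => xl.
set s := (fun n => (\int[mu]_t (g n t)%:E)%E) in xl *.
have cs : einfs s @ \oo --> ereal_sup (range (einfs s)).
  exact/ereal_nondecreasing_cvgn/nondecreasing_einfs.
rewrite (cvg_lim _ cs)// in xl.
have : ((x - e)%:E < ereal_sup (range (einfs s)))%E.
  by apply: lt_le_trans xl; rewrite lte_fin ltrBlDr ltrDl.
move/ereal_sup_gt => [_ [n _ <-]] h; near=> m.
apply: lt_le_trans h _; apply: ereal_inf_lbound; exists m => //=.
by near: m; exact: nbhs_infty_ge.
Unshelve. all: by end_near. Qed.

Definition ccvg (z : nat -> R[i]) (l : R[i]) :=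
  (fun n => complex.Re (z n)) @ \oo --> complex.Re l /\
  (fun n => complex.Im (z n)) @ \oo --> complex.Im l.

(** Pointwise convergence without gain of norm is strong enough to pass to the
   limit in inner products: Fatou's lemma bounds both |a + b| and |a - b| from
   below, and by polarization the inner product from both sides. *)
Lemma ip_cvg (a b : nat -> T -> R[i]) (A B : T -> R[i]) :
  (forall n, L2 (a n)) -> (forall n, L2 (b n)) -> L2 A -> L2 B ->
  (forall n, ip (a n) (a n) <= ip A A) -> (forall n, ip (b n) (b n) <= ip B B) ->
  (forall x, ccvg (a^~ x) (A x)) -> (forall x, ccvg (b^~ x) (B x)) ->
  (fun n => ip (a n) (b n)) @ \oo --> ip A B.
Proof.
move=> ha hb hA hB na nb ca cb.
have expand (s : R) u v : s * s = 1 -> L2 u -> L2 v ->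
    L2 (fun x => u x + s%:C * v x) /\
    ip (fun x => u x + s%:C * v x) (fun x => u x + s%:C * v x) =
    ip u u + ip v v + 2 * s * ip u v.
  move=> s1 hu hv; have hs := L2Z s%:C hv; split; first exact: L2D.
  rewrite ipDl ?ipDr ?ipZl ?ipZr//; try exact: L2D.
  rewrite (ipC v u); transitivity (ip u u + s * s * ip v v + 2 * s * ip u v).
    by ring.
  by rewrite s1 mul1r.
have key (s e : R) : s * s = 1 -> 0 < e ->
    \forall n \near \oo, s * ip A B - e < s * ip (a n) (b n).
  move=> s1 e0.
  have [hAB eAB] := expand _ _ _ s1 hA hB.
  have := @fatou_eventually
    (fun n x => cdot (a n x + s%:C * b n x) (a n x + s%:C * b n x))
    (fun x => cdot (A x + s%:C * B x) (A x + s%:C * B x))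
    (ip A A + ip B B + 2 * s * ip A B) (2 * e).
  case.
  - by move=> n; have [h _] := expand _ _ _ s1 (ha n) (hb n); apply: measurable_cdot; case: h.
  - by move=> n t; exact: cdot_ge0.
  - move=> t; rewrite /cdot; have [a1 a2] := ca t; have [b1 b2] := cb t.
    under eq_fun do rewrite !ReImE; rewrite !ReImE.
    apply: cvgD; apply: cvgM; apply: cvgD => //; (apply: cvgB || apply: cvgD);
      by apply: cvgM => //; exact: cvg_cst.
  - by rewrite -eAB -(sqnormE hAB).
  - by rewrite mulr_gt0.
  move=> N _ H; exists N => // n /H.
  have [hn en] := expand _ _ _ s1 (ha n) (hb n).
  rewrite /= -/(sqnorm _) (sqnormE hn) lte_fin en.
  have := na n; have := nb n; lra.
apply/cvgrPdist_lt => e e0.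
have k1 := key 1 e (mulr1 1) e0.
have k2 := key (-1) e ltac:(by rewrite mulrNN mulr1) e0.
near=> n.
have : 1 * ip A B - e < 1 * ip (a n) (b n) by near: n.
have : -1 * ip A B - e < -1 * ip (a n) (b n) by near: n.
by move=> h1 h2; rewrite ltr_norml; apply/andP; split; lra.
Unshelve. all: by end_near. Qed.

End SquareIntegrable.

(** * Weyl operators *)

Lemma cdot_young (R : realType) (z w : R[i]) (h : R) : 0 < h ->
  cdot z w <= (2 * h)^-1 * cdot z z + h / 2 * cdot w w.
Proof.
move=> h0; have hn0 : h != 0 by rewrite gt_eqF.
have -> : (2 * h)^-1 * cdot z z + h / 2 * cdot w w = cdot z w +
    (2 * h)^-1 * cdot (z - h%:C * w) (z - h%:C * w).
  rewrite /cdot !ReImE; move: (complex.Re z) (complex.Im z) (complex.Re w) (complex.Im w).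
  by move=> *; field.
by rewrite lerDl mulr_ge0 ?cdot_ge0// invr_ge0 mulr_ge0// ltW.
Qed.

Section WeylOperators.
Variable R : realType.
Local Notation line := (measurableTypeR R).
Local Notation plane := (line * line)%type.
Local Notation mu := (@lebesgue_measure R).
Local Notation mu2 := (mu \x mu)%E.
Implicit Types (F G D : plane -> R[i]) (a b s t : R) (p : plane).

Definition phase t : R[i] := cexp (ci * t%:C).

Lemma phaseD s t : phase (s + t) = phase s * phase t.
Proof. by rewrite /phase rmorphD mulrDr cexpD. Qed.

Lemma phase0 : phase 0 = 1.
Proof. by rewrite /phase mulr0 cexp0. Qed.

Lemma phaseE t : phase t = (cos t)%:C + (sin t)%:C * ci.
Proof.
have h1 : complex.Re (ci * t%:C) = 0 by rewrite !ReImE; ring.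
have h2 : complex.Im (ci * t%:C) = t by rewrite !ReImE; ring.
by apply: complex_ext; rewrite /phase /cexp h1 h2 expR0 !ReImE; ring.
Qed.

Lemma cdot_phase t : cdot (phase t) (phase t) = 1.
Proof. by rewrite phaseE /cdot !ReImE -[RHS](cos2Dsin2 t); ring. Qed.

(** Translation by (a, b), twisted by the phase that makes it the image of the
   Weyl operator f |-> f(z + v) exp(- conj v z - |v|^2 / 2), v = a + ib, of the
   Fock space under multiplication by the square root of the density. *)
Definition weyl a b F : plane -> R[i] :=
  fun p => phase (b * p.1 - a * p.2) * F (p.1 + a, p.2 + b).

Lemma cmeasurable_shift F a b : cmeasurable F ->
  cmeasurable (fun p => F (p.1 + a, p.2 + b)).
Proof.
move=> [m1 m2]; split.
  exact: (measurableT_comp m1 (measurable_shift2 a b)).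
exact: (measurableT_comp m2 (measurable_shift2 a b)).
Qed.

Lemma cmeasurable_weyl a b F : cmeasurable F -> cmeasurable (weyl a b F).
Proof.
move=> mF; apply: cmeasurableM; last exact: cmeasurable_shift.
have m : measurable_fun setT (fun p : plane => b * p.1 - a * p.2).
  by apply: measurable_funB; apply: measurable_funM; try exact: measurable_cst;
    [exact: measurable_fst|exact: measurable_snd].
split; under eq_fun do rewrite phaseE !ReImE !(mulr0, mul0r, mulr1, subr0, addr0, add0r).
  exact: (measurableT_comp (continuous_measurable_fun (@continuous_cos R)) m).
exact: (measurableT_comp (continuous_measurable_fun (@continuous_sin R)) m).
Qed.

Lemma cdot_weyl a b F p :
  cdot (weyl a b F p) (weyl a b F p) =
  cdot (F (p.1 + a, p.2 + b)) (F (p.1 + a, p.2 + b)).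
Proof. by rewrite cdotM cdot_phase mul1r. Qed.

Lemma sqnorm_weyl a b F : cmeasurable F ->
  sqnorm mu2 (weyl a b F) = sqnorm mu2 F.
Proof.
move=> mF; rewrite /sqnorm; under eq_integral do rewrite cdot_weyl.
apply: (integral_shift2 (G := fun p => (cdot (F p) (F p))%:E)).
  by apply/measurable_EFinP; exact: measurable_cdot.
by move=> p; rewrite lee_fin cdot_ge0.
Qed.

Lemma L2_weyl a b F : L2 mu2 F -> L2 mu2 (weyl a b F).
Proof.
by move=> [mF F2]; split; [exact: cmeasurable_weyl|rewrite sqnorm_weyl].
Qed.

Lemma ip_weyl_self a b F : L2 mu2 F -> ip mu2 (weyl a b F) (weyl a b F) = ip mu2 F F.
Proof.
move=> hF; apply: EFin_inj.
by rewrite -(sqnormE hF) -(sqnormE (L2_weyl a b hF)) sqnorm_weyl//; case: hF.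
Qed.

Lemma ip_weyl a b F G : L2 mu2 F -> L2 mu2 G ->
  ip mu2 (weyl a b F) (weyl a b G) = ip mu2 F G.
Proof.
move=> hF hG.
have pol u v : L2 mu2 u -> L2 mu2 v -> ip mu2 (fun p => u p + v p) (fun p => u p + v p) =
    ip mu2 u u + ip mu2 v v + 2 * ip mu2 u v.
  move=> hu hv; rewrite ipDl ?ipDr//; try exact: L2D.
  by rewrite (ipC _ v u); ring.
have := ip_weyl_self a b (L2D hF hG).
have -> : weyl a b (fun p => F p + G p) = fun p => weyl a b F p + weyl a b G p.
  by apply/funext => p; rewrite /weyl mulrDr.
rewrite (pol _ _ hF hG) (pol _ _ (L2_weyl a b hF) (L2_weyl a b hG)).
by rewrite !ip_weyl_self//; lra.
Qed.

(** Composition is commutative only up to a phase: this is where the right-hand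
   side of the uncertainty inequality comes from. *)
Lemma weyl_comp a b a' b' F p :
  weyl a b (weyl a' b' F) p = phase (b' * a - a' * b) * weyl (a + a') (b + b') F p.
Proof.
rewrite /weyl/= [LHS]mulrA [RHS]mulrA -!phaseD; congr (phase _ * F (_, _)); ring.
Qed.

Lemma weylZ c a b F p : weyl a b (fun q => c * F q) p = c * weyl a b F p.
Proof. by rewrite /weyl mulrCA. Qed.

Lemma weyl0 F p : weyl 0 0 F p = F p.
Proof. by rewrite /weyl !mul0r subrr phase0 mul1r !addr0; case: p. Qed.

Lemma weylK a b F : weyl a b (weyl (- a) (- b) F) = F.
Proof.
apply/funext => p; rewrite weyl_comp !subrr weyl0.
by rewrite (_ : _ - _ = 0) ?phase0 ?mul1r//; ring.
Qed.

Lemma ip_weyl_adj a b F G : L2 mu2 F -> L2 mu2 G ->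
  ip mu2 (weyl a b F) G = ip mu2 F (weyl (- a) (- b) G).
Proof.
move=> hF hG; rewrite -[in LHS](weylK a b G) ip_weyl//; exact: L2_weyl.
Qed.

(** The infinitesimal generator of the one-parameter group
   s |-> weyl (s a) (s b) maps F to D, in a pointwise sense that allows the
   fundamental theorem of calculus along orbits. *)
Definition generator a b F D := forall p,
  (forall s, cderiv (fun t => weyl (t * a) (t * b) F p) s
                    (weyl (s * a) (s * b) D p)) /\
  continuous (fun t => complex.Re (weyl (t * a) (t * b) D p)) /\
  continuous (fun t => complex.Im (weyl (t * a) (t * b) D p)).

(** An increment is the integral of the derivative along the orbit; the
   inequality is Cauchy-Schwarz for this integral. *)
Lemma generator_increment a b F D p h : generator a b F D -> 0 < h ->
  ((cdot (weyl (h * a) (h * b) F p - F p) (weyl (h * a) (h * b) F p - F p))%:E <=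
   h%:E * \int[mu]_(s in `[0%R, h])
     (cdot (D (p.1 + s * a, p.2 + s * b)) (D (p.1 + s * a, p.2 + s * b)))%:E)%E.
Proof.
move=> /(_ p)[gD [c1 c2]] h0; set e := weyl _ _ _ _ - _.
under eq_integral do rewrite -cdot_weyl.
set W := fun s => weyl (s * a) (s * b) D p in gD c1 c2 *.
have ccdot (u v : R -> R[i]) : continuous (fun t => complex.Re (u t)) ->
    continuous (fun t => complex.Im (u t)) -> continuous (fun t => complex.Re (v t)) ->
    continuous (fun t => complex.Im (v t)) -> continuous (fun t => cdot (u t) (v t)).
  by move=> u1 u2 v1 v2 t; apply: cvgD; apply: cvgM; [exact: u1|exact: v1|exact: u2|exact: v2].
have ck := ccdot W W c1 c2 c1 c2.
have ce : continuous (fun t => cdot e (W t)).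
  by apply: ccdot => //; exact: cst_continuous.
have int0h (g : R -> R) : continuous g -> mu.-integrable `[0, h] (EFin \o g).
  move=> cg; apply: continuous_compact_integrable; first exact: segment_compact.
  exact: continuous_subspaceT.
(* Projecting on the increment e itself reduces to a real function. *)
pose phi t := cdot e (weyl (t * a) (t * b) F p).
have dphi s : is_derive s 1 phi (cdot e (W s)) := cderiv_cdot e (gD s).
have cphi : continuous phi.
  move=> s; apply: differentiable_continuous; apply/derivable1_diffP.
  exact: ex_derive.
have ftc : (\int[mu]_(s in `[0%R, h]) (cdot e (W s))%:E = (cdot e e)%:E)%E.
  rewrite (@continuous_FTC2 _ _ phi)//.
  - rewrite /phi -EFinB !mul0r weyl0; congr EFin; rewrite /e /cdot !ReImE; ring.
  - exact: continuous_subspaceT.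
  - split; first by move=> s _; exact: ex_derive.
      exact/cvg_at_right_filter/cphi.
    exact/cvg_at_left_filter/cphi.
  - by move=> s _; rewrite derive1E; exact: derive_val.
have hn0 : h != 0 by rewrite gt_eqF.
have young s := cdot_young e (W s) h0.
have ice := int0h _ ce; have ick := int0h _ ck.
have icc : mu.-integrable `[0, h] (EFin \o (fun=> (2 * h)^-1 * cdot e e)).
  by apply: int0h; exact: cst_continuous.
have ick2 : mu.-integrable `[0, h] (EFin \o (fun s => h / 2 * cdot (W s) (W s))).
  by apply: int0h => s; apply: cvgM; [exact: cvg_cst|exact: ck].
have mh : measurable (`[0, h]%classic : set line) by exact: measurable_itv.
have muh : mu `[0%R, h] = h%:E.
  by rewrite lebesgue_measure_itv/= lte_fin h0 oppr0 adde0.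
have Kfin := integrable_fin_num mh ick.
have bound : ((cdot e e)%:E <= (cdot e e / 2)%:E +
    (h / 2)%:E * \int[mu]_(s in `[0%R, h]) (cdot (W s) (W s))%:E)%E.
  rewrite -{1}ftc -integralZl//.
  have -> : ((cdot e e / 2)%:E = \int[mu]_(s in `[0%R, h]) ((2 * h)^-1 * cdot e e)%:E)%E.
    transitivity (((2 * h)^-1 * cdot e e)%:E * mu `[0%R, h])%E; last first.
      exact/esym/(integral_cst mu mh).
    by rewrite muh -EFinM; congr EFin; field.
  rewrite -integralD//.
  apply: le_integral => //; first exact: integrableD.
  by move=> s _; rewrite -EFinM -EFinD lee_fin young.
move: bound; rewrite -(fineK Kfin) -!EFinM -EFinD !lee_fin; lra.
Qed.

Lemma measurable_orbit D a b : cmeasurable D ->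
  measurable_fun setT (fun q : plane * line =>
    cdot (D (q.1.1 + q.2 * a, q.1.2 + q.2 * b)) (D (q.1.1 + q.2 * a, q.1.2 + q.2 * b))).
Proof.
move=> mD.
have m c (i : plane -> line) : measurable_fun setT i ->
    measurable_fun setT (fun q : plane * line => (i q.1 + q.2 * c : line)).
  move=> mi; apply: measurable_funD; first exact: (measurableT_comp mi measurable_fst).
  by apply: measurable_funM; [exact: measurable_snd|exact: measurable_cst].
have ms : measurable_fun setT (fun q : plane * line =>
    (q.1.1 + q.2 * a, q.1.2 + q.2 * b) : plane).
  by apply/measurable_fun_pairP; split; [apply: m measurable_fst|apply: m measurable_snd].
exact: (measurableT_comp (measurable_cdot mD mD) ms).
Qed.

(** The group is unitary, so that averaging the derivative along an orbit does
   not increase norms: difference quotients are bounded by the derivative. *)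
Lemma generator_bound a b F D h : generator a b F D -> cmeasurable F ->
  cmeasurable D -> 0 < h ->
  (sqnorm mu2 (fun p => (weyl (h * a) (h * b) F p - F p)%R) <= (h * h)%:E * sqnorm mu2 D)%E.
Proof.
move=> gD mF mD h0.
have mN (u : plane -> R[i]) : cmeasurable u -> cmeasurable (fun p => - u p).
  move=> [m1 m2]; split; [under eq_fun do rewrite Re_opp|under eq_fun do rewrite Im_opp].
    exact: (measurableT_comp (@oppr_measurable _ _) m1).
  exact: (measurableT_comp (@oppr_measurable _ _) m2).
have mi := cmeasurableD (cmeasurable_weyl (h * a) (h * b) mF) (mN _ mF).
(* The indicator I moves the bounds of the orbit integral into the integrand. *)
pose I s : R := \1_(`[0, h]%classic : set R) s.
pose K (q : plane * line) : \bar R := ((I q.2) *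
  cdot (D (q.1.1 + q.2 * a, q.1.2 + q.2 * b)) (D (q.1.1 + q.2 * a, q.1.2 + q.2 * b)))%:E.
have I0 s : 0 <= I s by rewrite /I indicE.
have mI : measurable_fun setT (I : line -> R) by exact: measurable_indic.
have mK : measurable_fun setT K.
  apply/measurable_EFinP; apply: measurable_funM; last exact: measurable_orbit.
  exact: (measurableT_comp mI measurable_snd).
have K0 q : (0 <= K q)%E by rewrite lee_fin mulr_ge0 ?cdot_ge0.
have KE p : (\int[mu]_(s in `[0%R, h])
     (cdot (D (p.1 + s * a, p.2 + s * b)) (D (p.1 + s * a, p.2 + s * b)))%:E =
     \int[mu]_s K (p, s))%E.
  rewrite integral_mkcond; apply: eq_integral => s _; rewrite patchE /K /I indicE/=.
  by case: ifPn; rewrite ?mul1r ?mul0r.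
apply: (@le_trans _ _ (\int[mu2]_p (h%:E * \int[mu]_s K (p, s)))%E).
  apply: ge0_le_integral => //.
  - by move=> p _; rewrite lee_fin cdot_ge0.
  - by apply/measurable_EFinP; exact: measurable_cdot.
  - apply: emeasurable_funM; first exact: measurable_cst.
    exact: (measurable_fun_fubini_tonelli_F (m2 := mu)).
  - by move=> p _; rewrite -KE; exact: generator_increment.
rewrite ge0_integralZl//; last 3 first.
- exact: (measurable_fun_fubini_tonelli_F (m2 := mu)).
- by move=> p _; exact: integral_ge0.
- by rewrite lee_fin ltW.
have swap : (\int[mu2]_p \int[mu]_s K (p, s) = \int[mu]_s \int[mu2]_p K (p, s))%E.
  exact: tonelli_prod.
rewrite swap EFinM -muleA.
apply: lee_wpmul2l; first by rewrite lee_fin ltW.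
have inner s : (\int[mu2]_p K (p, s) = (I s)%:E * sqnorm mu2 D)%E.
  rewrite /K/=; under eq_integral do rewrite EFinM.
  rewrite ge0_integralZl//; last 3 first.
  - apply/measurable_EFinP.
    have mDs := cmeasurable_shift (s * a) (s * b) mD.
    exact: (measurable_cdot mDs mDs).
  - by move=> p _; rewrite lee_fin cdot_ge0.
  - by rewrite lee_fin.
  congr (_ * _)%E; rewrite /sqnorm.
  apply: (integral_shift2 (G := fun p => (cdot (D p) (D p))%:E)).
    by apply/measurable_EFinP; exact: measurable_cdot.
  by move=> p; rewrite lee_fin cdot_ge0.
under eq_integral do rewrite inner.
rewrite ge0_integralZr//; last 3 first.
- exact/measurable_EFinP.
- by move=> s _; rewrite lee_fin.
- exact: sqnorm_ge0.
apply: lee_wpmul2r; first exact: sqnorm_ge0.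
have muh : mu `[0%R, h] = h%:E.
  by rewrite lebesgue_measure_itv/= lte_fin h0 oppr0 adde0.
rewrite integral_indic// setIT -[leRHS]muh.
exact: lexx.
Qed.

End WeylOperators.

(** * The commutation relation *)

Section CommutationIdentities.
Variable R : realType.
Local Notation line := (measurableTypeR R).
Local Notation plane := (line * line)%type.
Local Notation mu := (@lebesgue_measure R).
Local Notation mu2 := (mu \x mu)%E.
Local Notation ip := (ip mu2).
Local Notation L2 := (L2 mu2).
Implicit Types (F D X Y : plane -> R[i]) (a b h : R) (u : nat -> R).

Lemma cvg_ext (g k : nat -> R) (l : R) : g =1 k -> g @ \oo --> l -> k @ \oo --> l.
Proof. by move=> /funext ->. Qed.

Lemma seq_cvg_unique (g : nat -> R) (l k : R) :
  g @ \oo --> l -> g @ \oo --> k -> l = k.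
Proof. by move=> gl gk; exact: (cvg_unique (@Rhausdorff R) gl gk). Qed.

Lemma is_derive_cvg (g : R -> R) (x d : R) u : is_derive x 1 g d ->
  u @ \oo --> 0 -> (forall n, u n != 0) ->
  (fun n => (u n)^-1 * (g (u n + x) - g x)) @ \oo --> d.
Proof.
move=> gd u0 un.
have c : (fun h : R => h^-1 *: (g (h *: (1 : R) + x) - g x)) @ 0^' --> d.
  by rewrite -(derive_val (is_derive := gd)); exact: (ex_derive (is_derive := gd)).
have cu : u @ \oo --> (0 : R)^'.
  move=> A; rewrite /dnbhs/= => /u0; rewrite /nbhs/= => -[N _ H].
  by exists N => // n /H; apply; exact: un.
apply: cvg_ext (cvg_comp _ _ cu c) => n /=.
by rewrite /GRing.scale/= mulr1.
Qed.

Lemma cderiv_cvg (g : R -> R[i]) (d : R[i]) u : cderiv g 0 d ->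
  u @ \oo --> 0 -> (forall n, u n != 0) ->
  ccvg (fun n => ((u n)^-1)%:C * (g (u n) - g 0)) d.
Proof.
move=> [g1 g2] u0 un; split.
  apply: cvg_ext (is_derive_cvg g1 u0 un) => n.
  by rewrite addr0 !ReImE mul0r subr0.
apply: cvg_ext (is_derive_cvg g2 u0 un) => n.
by rewrite addr0 !ReImE mul0r addr0.
Qed.

Lemma ccvgZ (c : R[i]) (z : nat -> R[i]) (l : R[i]) : ccvg z l ->
  ccvg (fun n => c * z n) (c * l).
Proof.
move=> [z1 z2]; split; under eq_fun do rewrite !ReImE; rewrite !ReImE.
  by apply: cvgB; apply: cvgM => //; exact: cvg_cst.
by apply: cvgD; apply: cvgM => //; exact: cvg_cst.
Qed.

Lemma ccvg_cst (c : R[i]) : ccvg (fun=> c) c.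
Proof. by split; exact: cvg_cst. Qed.

Definition dquot a b F h : plane -> R[i] :=
  fun p => (h^-1)%:C * (weyl (h * a) (h * b) F p - F p).

Lemma L2_dquot a b F h : L2 F -> L2 (dquot a b F h).
Proof. by move=> hF; apply: L2Z; apply: L2B => //; exact: L2_weyl. Qed.

Lemma ip_dquot_le a b F D h : generator a b F D -> L2 F -> L2 D -> h != 0 ->
  ip (dquot a b F h) (dquot a b F h) <= ip D D.
Proof.
move=> gD hF hD h0.
have pos k : 0 < k ->
    ip (fun p => weyl (k * a) (k * b) F p - F p) (fun p => weyl (k * a) (k * b) F p - F p)
    <= k * k * ip D D.
  move=> k0; have := generator_bound gD hF.1 hD.1 k0.
  by rewrite (sqnormE hD) sqnormE ?lee_fin//; apply: L2B => //; exact: L2_weyl.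
have hd k : L2 (fun p => weyl (k * a) (k * b) F p - F p).
  by apply: L2B => //; exact: L2_weyl.
(* Negative increments reduce to positive ones by unitarity. *)
have all_h : ip (fun p => weyl (h * a) (h * b) F p - F p) (fun p => weyl (h * a) (h * b) F p - F p)
    <= h * h * ip D D.
  have [hp|hn|e] := ltgtP 0 h; [exact: pos| |by rewrite -e eqxx in h0].
  have hp : 0 < - h by rewrite oppr_gt0.
  have := pos _ hp; rewrite mulrNN; apply: le_trans.
  rewrite -(ip_weyl (- h * a) (- h * b) (hd h) (hd h)).
  have -> : weyl (- h * a) (- h * b) (fun p => weyl (h * a) (h * b) F p - F p) =
      fun p => - (weyl (- h * a) (- h * b) F p - F p).
    have K := weylK (- h * a) (- h * b) F; rewrite !mulNr !opprK in K *.
    apply/funext => p; rewrite opprB.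
    have -> : F p = weyl (- (h * a)) (- (h * b)) (weyl (h * a) (h * b) F) p by rewrite K.
    by rewrite /weyl mulrBr.
  by rewrite ipNN.
rewrite /dquot ipZl ?ipZr//; try exact: L2Z.
have : 0 < h * h by rewrite -expr2 exprn_even_gt0.
move=> hh; by rewrite mulrA -invfM ler_pdivrMl.
Qed.

Lemma dquot_cvg a b F D u p : generator a b F D -> u @ \oo --> 0 ->
  (forall n, u n != 0) -> ccvg (fun n => dquot a b F (u n) p) (D p).
Proof.
move=> /(_ p)[gD _] u0 un; have := gD 0; rewrite !mul0r weyl0 => g0.
have := cderiv_cvg g0 u0 un.
by congr (ccvg _ _); apply/funext => n; rewrite /= !mul0r weyl0.
Qed.

Lemma ip_dquotl a b F G h : L2 F -> L2 G ->
  ip (dquot a b F h) G = h^-1 * (ip (weyl (h * a) (h * b) F) G - ip F G).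
Proof.
move=> hF hG; rewrite /dquot ipZl ?ipBl//; try exact: L2_weyl.
by apply: L2B => //; exact: L2_weyl.
Qed.

(** The group is unitary, hence its generator is antisymmetric. *)
Lemma generator_antisym a b F D : generator a b F D -> L2 F -> L2 D -> ip D F = 0.
Proof.
move=> gD hF hD.
pose v : nat -> R := fun n => n.+1%:R^-1.
have v0 : v @ \oo --> 0 by exact: cvg_harmonic.
have vn n : v n != 0 by rewrite invr_eq0 pnatr_eq0.
have w0 : (fun n => - v n) @ \oo --> 0 by rewrite -oppr0; exact: cvgN.
have wn n : - v n != 0 by rewrite oppr_eq0.
have c1 : (fun n => ip (dquot a b F (v n)) F) @ \oo --> ip D F.
  apply: (ip_cvg (b := fun=> F)).
  - by move=> n; exact: L2_dquot.
  - by move=> _; exact: hF.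
  - exact: hD.
  - exact: hF.
  - by move=> n; exact: ip_dquot_le.
  - by move=> _; exact: lexx.
  - by move=> p; exact: dquot_cvg.
  - by move=> p; exact: ccvg_cst.
have c2 : (fun n => ip (dquot a b F (- v n)) F) @ \oo --> ip D F.
  apply: (ip_cvg (b := fun=> F)).
  - by move=> n; exact: L2_dquot.
  - by move=> _; exact: hF.
  - exact: hD.
  - exact: hF.
  - by move=> n; exact: ip_dquot_le.
  - by move=> _; exact: lexx.
  - by move=> p; exact: (dquot_cvg p gD w0 wn).
  - by move=> p; exact: ccvg_cst.
have E : (fun n => ip (dquot a b F (- v n)) F) = (fun n => - ip (dquot a b F (v n)) F).
  apply/funext => n; rewrite !ip_dquotl// ip_weyl_adj// ipC !mulNr !opprK invrN.
  by rewrite mulNr.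
rewrite E in c2.
have c3 : (fun n => - ip (dquot a b F (v n)) F) @ \oo --> - ip D F by exact: cvgN.
by have := seq_cvg_unique c2 c3 => H; lra.
Qed.

Lemma L2_ci F : L2 F -> L2 (fun p => ci * F p).
Proof. exact: L2Z. Qed.

Lemma ip_phase (t : R) F G : L2 F -> L2 G ->
  ip (fun p => phase t * F p) (fun p => ci * G p) =
  cos t * ip F (fun p => ci * G p) + sin t * ip F G.
Proof.
move=> hF hG.
have -> : (fun p => phase t * F p) =
    (fun p => (cos t)%:C * F p + (sin t)%:C * (ci * F p)).
  by apply/funext => p; rewrite phaseE mulrDl mulrA.
by rewrite ipDl ?ipZl ?ip_rot//; do ?[apply: L2Z => //].
Qed.

(** The two compositions of the translations by h and ih differ from the
   translation by h + ih by opposite phases; expanding them in difference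
   quotients, all the terms of first order in h cancel. *)
Lemma dquot_commutator F h : L2 F -> h != 0 ->
  ip (dquot 1 0 F h) (fun p => ci * dquot 0 1 F (- h) p) -
  ip (dquot 0 1 F h) (fun p => ci * dquot 1 0 F (- h) p) =
  2 * ((h * h)^-1 * sin (h * h)) * ip (weyl (h * 1) (h * 1) F) F.
Proof.
move=> hF h0.
have ci_dquot a b k : (fun p => ci * dquot a b F k p) =
    (fun p => (k^-1)%:C * ((weyl (k * a) (k * b) (fun p => ci * F p) p) - ci * F p)).
  by apply/funext => p; rewrite /dquot weylZ; ring.
have hciF := L2_ci hF.
have ex a b a' b' : ip (dquot a b F h) (fun p => ci * dquot a' b' F (- h) p) =
    - (h * h)^-1 * (ip (weyl (h * a) (h * b) F) (weyl (- h * a') (- h * b') (fun p => ci * F p))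
      - ip (weyl (h * a) (h * b) F) (fun p => ci * F p)
      - ip F (weyl (- h * a') (- h * b') (fun p => ci * F p))).
  rewrite ci_dquot ipZr; [|by apply: L2B => //; exact: L2_weyl|exact: L2_dquot].
  rewrite ip_dquotl//; last by apply: L2B => //; exact: L2_weyl.
  rewrite !ipBr//; try exact: L2_weyl.
  by rewrite ip_rot_self; field.
rewrite !ex.
have adj a b : ip F (weyl (- h * a) (- h * b) (fun p => ci * F p)) =
    ip (weyl (h * a) (h * b) F) (fun p => ci * F p).
  by rewrite !mulNr -ip_weyl_adj.
have adj2 a b a' b' :
    ip (weyl (h * a) (h * b) F) (weyl (- h * a') (- h * b') (fun p => ci * F p)) =
    ip (weyl (h * a') (h * b') (weyl (h * a) (h * b) F)) (fun p => ci * F p).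
  by rewrite !mulNr -ip_weyl_adj//; exact: L2_weyl.
pose S := weyl (h * 1) (h * 1) F.
have comp1 : weyl (h * 0) (h * 1) (weyl (h * 1) (h * 0) F) = fun p => phase (- (h * h)) * S p.
  by apply/funext => p; rewrite weyl_comp; congr (phase _ * weyl _ _ F p); ring.
have comp2 : weyl (h * 1) (h * 0) (weyl (h * 0) (h * 1) F) = fun p => phase (h * h) * S p.
  by apply/funext => p; rewrite weyl_comp; congr (phase _ * weyl _ _ F p); ring.
have hS : L2 S by exact: L2_weyl.
have e1 : ip (weyl (h * 0) (h * 1) (weyl (h * 1) (h * 0) F)) (fun p => ci * F p) =
    cos (h * h) * ip S (fun p => ci * F p) - sin (h * h) * ip S F.
  by rewrite comp1 (ip_phase (- (h * h)) hS hF) cosN sinN mulNr.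
have e2 : ip (weyl (h * 1) (h * 0) (weyl (h * 0) (h * 1) F)) (fun p => ci * F p) =
    cos (h * h) * ip S (fun p => ci * F p) + sin (h * h) * ip S F.
  by rewrite comp2 (ip_phase (h * h) hS hF).
rewrite (adj2 1 0 0 1) (adj2 0 1 1 0) (adj 0 1) (adj 1 0) e1 e2.
move: (ip S F) (ip S _) (ip (weyl _ _ _) _) (ip (weyl _ _ _) _) (cos _) (sin _) => s1 s2 s3 s4 c s.
by ring.
Qed.

(** The weak form of the commutation relation between the generators in the
   directions 1 and i. It is the limit of dquot_commutator, hence holds as soon
   as F, X and Y are square-integrable: a direct integration by parts would
   involve second derivatives of F and terms at infinity. *)
Lemma commutator F X Y : L2 F -> L2 X -> L2 Y ->
  (forall a b, generator a b F (fun p => a%:C * X p + b%:C * Y p)) ->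
  ip X (fun p => ci * Y p) = ip F F.
Proof.
move=> hF hX hY gen.
have gX : generator 1 0 F X.
  by have := gen 1 0; congr generator; apply/funext => p; rewrite mul1r mul0r addr0.
have gY : generator 0 1 F Y.
  by have := gen 0 1; congr generator; apply/funext => p; rewrite mul1r mul0r add0r.
pose v : nat -> R := fun n => n.+1%:R^-1.
have v0 : v @ \oo --> 0 by exact: cvg_harmonic.
have vn n : v n != 0 by rewrite invr_eq0 pnatr_eq0.
have w0 : (fun n => - v n) @ \oo --> 0 by rewrite -oppr0; exact: cvgN.
have wn n : - v n != 0 by rewrite oppr_eq0.
have lim a b a' b' D D' : generator a b F D -> generator a' b' F D' -> L2 D -> L2 D' ->
    (fun n => ip (dquot a b F (v n)) (fun p => ci * dquot a' b' F (- v n) p))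
      @ \oo --> ip D (fun p => ci * D' p).
  move=> g g' hD hD'; apply: (ip_cvg (b := fun n p => ci * dquot a' b' F (- v n) p)).
  - by move=> n; exact: L2_dquot.
  - by move=> n; apply: L2_ci; exact: L2_dquot.
  - exact: hD.
  - exact: L2_ci.
  - by move=> n; exact: ip_dquot_le.
  - by move=> n; rewrite !ip_rot; exact: ip_dquot_le.
  - by move=> p; exact: dquot_cvg.
  - by move=> p; apply: ccvgZ; exact: (dquot_cvg p g' w0 wn).
have cS : (fun n => ip (weyl (v n * 1) (v n * 1) F) F) @ \oo --> ip F F.
  apply: (ip_cvg (b := fun=> F)).
  - by move=> n; exact: L2_weyl.
  - by move=> _; exact: hF.
  - exact: hF.
  - exact: hF.
  - by move=> n; rewrite ip_weyl_self.
  - by move=> _; exact: lexx.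
  - move=> p; have [/(_ 0) g _] := gen 1 1 p.
    have [c1 c2] := cderiv_continuous g.
    split.
      by have := cvg_comp _ _ v0 c1; rewrite !mul0r weyl0.
    by have := cvg_comp _ _ v0 c2; rewrite !mul0r weyl0.
  - by move=> p; exact: ccvg_cst.
have csin : (fun n => (v n * v n)^-1 * sin (v n * v n)) @ \oo --> (1 : R).
  have vv0 : (fun n => v n * v n) @ \oo --> 0 by rewrite -(mulr0 0); exact: cvgM.
  have vvn n : v n * v n != 0 by rewrite mulf_neq0.
  have := is_derive_cvg (is_derive_sin 0) vv0 vvn; rewrite cos0; apply: cvg_ext => n.
  by rewrite addr0 sin0 subr0.
have cl : (fun n => ip (dquot 1 0 F (v n)) (fun p => ci * dquot 0 1 F (- v n) p) -
    ip (dquot 0 1 F (v n)) (fun p => ci * dquot 1 0 F (- v n) p)) @ \oo -->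
    ip X (fun p => ci * Y p) - ip Y (fun p => ci * X p).
  by apply: cvgB; [exact: lim gX gY hX hY|exact: lim gY gX hY hX].
have cr : (fun n => 2 * ((v n * v n)^-1 * sin (v n * v n)) *
    ip (weyl (v n * 1) (v n * 1) F) F) @ \oo --> 2 * 1 * ip F F.
  by apply: cvgM => //; apply: cvgM => //; exact: cvg_cst.
have := seq_cvg_unique cl (cvg_ext (fun n => esym (dquot_commutator hF (vn n))) cr).
have -> : ip Y (fun p => ci * X p) = - ip X (fun p => ci * Y p).
  by rewrite ipC ip_rotl.
by move=> H; lra.
Qed.

End CommutationIdentities.

(** * The Fock space inside L^2 of the plane *)

Section FockToPlane.
Variable R : realType.
Local Notation line := (measurableTypeR R).
Local Notation plane := (line * line)%type.
Local Notation mu := (@lebesgue_measure R).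
Local Notation mu2 := (mu \x mu)%E.
Implicit Types (f g : R[i] -> R[i]) (p q : plane) (a b s t : R).

Definition toC p : R[i] := p.1%:C + p.2%:C * ci.

Lemma mkC a b : a +i* b = a%:C + b%:C * ci.
Proof. by apply: complex_ext; rewrite !ReImE; ring. Qed.

Definition weight p : R := Num.sqrt pi^-1 * expR (- (p.1 ^+ 2 + p.2 ^+ 2) / 2).

(** An isometry from the Fock space into L^2 of the plane. *)
Definition fock_lift f : plane -> R[i] := fun p => (weight p)%:C * f (toC p).

Lemma weight_gt0 p : 0 < weight p.
Proof. by rewrite mulr_gt0 ?expR_gt0// sqrtr_gt0 invr_gt0 pi_gt0. Qed.

Lemma weight_sq p : weight p * weight p = fock_density (toC p).
Proof.
rewrite /fock_density normc_sq /cdot /weight mulrACA -expr2 sqr_sqrtr; last first.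
  by rewrite invr_ge0 pi_ge0.
by rewrite -expRD; congr (_ * expR _); rewrite /toC !ReImE; field.
Qed.

Lemma cdot_lift g p :
  cdot (fock_lift g p) (fock_lift g p) = Normc.normc (g (toC p)) ^+ 2 * fock_density (toC p).
Proof. by rewrite cdotM -weight_sq normc_sq mulrC /cdot !ReImE; ring. Qed.

Lemma fock_normE g : fock_norm g = sqrte (sqnorm mu2 (fock_lift g)).
Proof.
rewrite /fock_norm /sqnorm; under [in RHS]eq_integral do rewrite cdot_lift /toC -mkC.
by [].
Qed.

Lemma liftD f g : fock_lift (fun z => f z + g z) = fun p => fock_lift f p + fock_lift g p.
Proof. by apply/funext => p; rewrite /fock_lift mulrDr. Qed.

Lemma liftB f g : fock_lift (fun z => f z - g z) = fun p => fock_lift f p - fock_lift g p.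
Proof. by apply/funext => p; rewrite /fock_lift mulrBr. Qed.

Lemma liftZ (c : R[i]) f : fock_lift (fun z => c * f z) = fun p => c * fock_lift f p.
Proof. by apply/funext => p; rewrite /fock_lift mulrCA. Qed.

Lemma continuous2P (h : R * R -> R) : continuous h <-> continuous2 (h : plane -> R).
Proof.
split=> [ch p e e0|ch p].
  have /nbhs_ballP[r /= r0 H] : nbhs (p : R * R) [set q | `|h p - h q| < e].
    by move/cvgrPdist_lt: (ch p) => /(_ e e0).
  exists r => // q q1 q2; rewrite distrC; apply: H.
  by split; rewrite /ball/= distrC.
apply/cvgrPdist_lt => e e0; have [r r0 H] := ch p e e0.
suff : nbhs (p : R * R) [set q | `|h p - h q| < e] by [].
apply/nbhs_ballP; exists r => //= q [q1 q2]; rewrite /= distrC.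
by apply: H; rewrite distrC.
Qed.

Lemma weight_continuous : continuous (weight : R * R -> R).
Proof.
move=> p; apply: cvgM; first exact: cvg_cst.
apply: (@cvg_comp _ _ _ (fun p : R * R => - (p.1 ^+ 2 + p.2 ^+ 2) / 2) expR);
  last exact: continuous_expR.
apply: cvgM; last exact: cvg_cst.
apply: cvgN; apply: cvgD; rewrite expr2; apply: cvgM;
  by [exact: cvg_fst|exact: cvg_snd].
Qed.

Lemma entire_continuous f : entire f ->
  continuous (fun p : R * R => complex.Re (f (toC p))) /\
  continuous (fun p : R * R => complex.Im (f (toC p))).
Proof.
move=> ef.
have key (P : R[i] -> R) : (forall z w, P (z - w) = P z - P w) ->
    (forall z, `|P z| <= Normc.normc z) -> continuous (fun p : R * R => P (f (toC p))).
  move=> PB Pn; apply/continuous2P => p e e0.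
  have [r r0 H] := entire_near (toC p) ef e0.
  exists (r / 2); first by rewrite divr_gt0.
  move=> q q1 q2; rewrite -PB; apply: le_lt_trans (Pn _) (H _ _).
  apply: le_lt_trans (normc_le _) _.
  have -> : complex.Re (toC q - toC p) = q.1 - p.1 by rewrite /toC !ReImE; ring.
  have -> : complex.Im (toC q - toC p) = q.2 - p.2 by rewrite /toC !ReImE; ring.
  by rewrite [ltRHS]splitr ltrD.
by split; apply: key => *; rewrite ?ReImE//; [exact: Re_le_normc|exact: Im_le_normc].
Qed.

Lemma lift_continuous f : entire f ->
  continuous (fun p : R * R => complex.Re (fock_lift f p)) /\
  continuous (fun p : R * R => complex.Im (fock_lift f p)).
Proof.
move=> ef; have [c1 c2] := entire_continuous ef.
split; under eq_fun do rewrite /fock_lift !ReImE mul0r ?subr0 ?addr0.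
  by move=> p; apply: cvgM; [exact: weight_continuous|exact: c1].
by move=> p; apply: cvgM; [exact: weight_continuous|exact: c2].
Qed.

Lemma cmeasurable_lift f : entire f -> cmeasurable (fock_lift f).
Proof.
move=> /lift_continuous[c1 c2].
by split; apply: continuous2_measurable; apply/continuous2P.
Qed.

Lemma lift_ae0 f : entire f -> sqnorm mu2 (fock_lift f) = 0%E -> forall z, f z = 0.
Proof.
move=> ef f0 z; have [c1 c2] := lift_continuous ef.
have c : continuous2 (fun p : plane => cdot (fock_lift f p) (fock_lift f p)).
  apply/continuous2P => p; apply: cvgD; apply: cvgM;
    by [exact: c1|exact: c2].
have /= := continuous2_ae0 c (fun p => cdot_ge0 _) f0 (complex.Re z, complex.Im z).
move/cdot_eq0/eqP; rewrite mulf_eq0 => /orP[|/eqP].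
  by move/eqP/(congr1 (@complex.Re R)); rewrite !ReImE => /eqP; rewrite gt_eqF// weight_gt0.
by rewrite /toC/= -mkC; case: z.
Qed.

(** Relative to the weight at p, the weight and the phase at time t combine to
   exp(- t conj v z - t^2 |v|^2 / 2), where v = a + ib and z = toC p. The
   logarithmic derivative is - conj v times the current point z + t v; this is
   the term that turns v f' into v f' - conj v z f. *)
Lemma cderiv_weyl_lift f a b p s : entire f ->
  cderiv (fun t => weyl (t * a) (t * b) (fock_lift f) p) s
    (weyl (s * a) (s * b)
       (fock_lift (fun z => (a%:C + b%:C * ci) * derive1 f z - (a%:C - b%:C * ci) * z * f z)) p).
Proof.
move=> ef.
(* theta is the logarithm of the weight and phase, a quadratic polynomial in t. *)
pose A : R[i] := (- (p.1 ^+ 2 + p.2 ^+ 2) / 2)%:C.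
pose B : R[i] := ci * (b * p.1 - a * p.2)%:C - (a * p.1 + b * p.2)%:C.
pose C : R[i] := (- (a ^+ 2 + b ^+ 2) / 2)%:C.
pose theta t := A + t%:C * B + t%:C * t%:C * C.
pose c0 : R[i] := (Num.sqrt pi^-1)%:C.
have cexpR (r : R) : (expR r)%:C = cexp r%:C.
  by rewrite /cexp !ReImE cos0 sin0; apply: complex_ext; rewrite !ReImE; ring.
have E g t : weyl (t * a) (t * b) (fock_lift g) p =
    c0 * (cexp (theta t) * g (toC p + t%:C * (a%:C + b%:C * ci))).
  have -> : toC p + t%:C * (a%:C + b%:C * ci) = toC (p.1 + t * a, p.2 + t * b).
    rewrite /toC [(_, _).1]/= [(_, _).2]/=.
    by apply: complex_ext; rewrite !ReImE; ring.
  rewrite /weyl /fock_lift /weight/= rmorphM/= cexpR -/c0.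
  have -> : theta t = ci * (t * b * p.1 - t * a * p.2)%:C +
      (- ((p.1 + t * a) ^+ 2 + (p.2 + t * b) ^+ 2) / 2)%:C.
    by rewrite /theta /A /B /C; apply: complex_ext; rewrite !ReImE; field.
  by rewrite cexpD /phase; ring.
have -> : (fun t => weyl (t * a) (t * b) (fock_lift f) p) =
    (fun t => c0 * (cexp (theta t) * f (toC p + t%:C * (a%:C + b%:C * ci)))).
  by apply/funext => t; exact: E.
rewrite E.
have dtheta : cderiv theta s (B + (s + s)%:C * C).
  apply: cderiv_eq.
    apply: cderivD; first apply: cderivD.
    - exact: cderiv_cst.
    - exact: cderivM (cderiv_real s) (cderiv_cst B s).
    - exact: cderivM (cderivM (cderiv_real s) (cderiv_real s)) (cderiv_cst C s).
  by rewrite rmorphD; cbv beta; ring.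
apply: cderiv_eq.
  apply: cderivMl; apply: cderivM; first exact: cderiv_cexp dtheta.
  exact: cderiv_line.
cbv beta; set z := toC p + s%:C * (a%:C + b%:C * ci); set e := cexp (theta s).
have -> : B + (s + s)%:C * C = - ((a%:C - b%:C * ci) * z).
  by rewrite /B /C /z /toC; apply: complex_ext; rewrite !ReImE; field.
by ring.
Qed.

Lemma generator_lift f a b : entire f -> entire (derive1 f) ->
  generator a b (fock_lift f) (fock_lift (fun z =>
    (a%:C + b%:C * ci) * derive1 f z - (a%:C - b%:C * ci) * z * f z)).
Proof.
move=> ef ef' p.
set g := (fun z => _ - _ : R[i]).
have eg : entire g.
  exact (entireB (entireM (@entire_cst R (a%:C + b%:C * ci)) ef')
    (entireM (entireM (@entire_cst R (a%:C - b%:C * ci)) (@entire_id R)) ef)).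
split; first by move=> s; exact: cderiv_weyl_lift.
by split=> s; have [c1 c2] := cderiv_continuous (cderiv_weyl_lift a b p s eg).
Qed.

End FockToPlane.

(** * Geometry of the uncertainty inequality *)

Section TwoVectors.
Context d (T : measurableType d) (R : realType) (mu : {measure set T -> \bar R}).
Local Notation ip := (ip mu).
Local Notation L2 := (L2 mu).
Variables F X Z : T -> R[i].
Hypotheses (hF : L2 F) (hX : L2 X) (hZ : L2 Z).
(* The model is the image F of f, X of f' - z f and Z of f' + z f. *)
Hypotheses (XF : ip X F = 0) (ZF : ip Z (fun x => ci * F x) = 0).

Let hcF : L2 (fun x => ci * F x). Proof. exact: L2Z. Qed.

Let split_scalar (w : R[i]) : (fun x => w * F x) =
  (fun x => (complex.Re w)%:C * F x + (complex.Im w)%:C * (ci * F x)).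
Proof. by apply/funext => x; apply: complex_ext; rewrite !ReImE; ring. Qed.

Let ip_scalar (w : R[i]) (V : T -> R[i]) : L2 V -> ip V (fun x => w * F x) =
  complex.Re w * ip V F + complex.Im w * ip V (fun x => ci * F x).
Proof.
by move=> hV; rewrite split_scalar ipDr ?ipZr//; exact: L2Z.
Qed.

Let ip_scalar_self (w : R[i]) : ip (fun x => w * F x) (fun x => w * F x) = cdot w w * ip F F.
Proof.
rewrite /ip -RintegralZl//; last exact: integrable_cdot.
by congr Rintegral; apply/funext => x; rewrite cdotM.
Qed.

Let ip_sub (w : R[i]) (V : T -> R[i]) : L2 V ->
  ip (fun x => V x - w * F x) (fun x => V x - w * F x) =
  ip V V - 2 * ip V (fun x => w * F x) + cdot w w * ip F F.
Proof.
move=> hV; have hw : L2 (fun x => w * F x) by exact: L2Z.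
rewrite ipBl ?ipBr//; last exact: L2B.
by rewrite ip_scalar_self (ipC _ _ V); ring.
Qed.

Lemma ip_sub_X (w : R[i]) : ip (fun x => X x - w * F x) (fun x => X x - w * F x) =
  ip X X - 2 * complex.Im w * ip X (fun x => ci * F x) + cdot w w * ip F F.
Proof. by rewrite ip_sub// ip_scalar// XF; ring. Qed.

Lemma ip_sub_Z (w : R[i]) : ip (fun x => Z x - w * F x) (fun x => Z x - w * F x) =
  ip Z Z - 2 * complex.Re w * ip Z F + cdot w w * ip F F.
Proof. by rewrite ip_sub// ip_scalar// ZF; ring. Qed.

(** Real shifts of Z and imaginary shifts of X do not change their product. *)
Lemma ip_sub_XZ (a b : R) :
  ip (fun x => X x - b%:C * ci * F x) (fun x => Z x - a%:C * F x) = ip X Z.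
Proof.
have haF : L2 (fun x => a%:C * F x) by exact: L2Z.
have hbF : L2 (fun x => b%:C * ci * F x) by exact: L2Z.
have e1 : ip (fun x => b%:C * ci * F x) Z = 0 by rewrite ipC ip_scalar// !ReImE ZF; ring.
have e2 : ip (fun x => b%:C * ci * F x) F = 0.
  by rewrite ipC ip_scalar// !ReImE ip_rot_self; ring.
rewrite ipBl ?ipBr//; last exact: L2B.
by rewrite !ipZr// XF e1 e2; ring.
Qed.

Hypotheses (XZ : ip X Z = - ip F F) (F0 : 0 < ip F F).

Definition argX := ip X (fun x => ci * F x) / ip F F.
Definition argZ := ip Z F / ip F F.
(** The squared distances from X and from Z to the complex line of F. As X is
   orthogonal to F and Z to i F, the nearest points are the multiples i argX F
   and argZ F. *)
Definition minX := ip X X - ip X (fun x => ci * F x) ^+ 2 / ip F F.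
Definition minZ := ip Z Z - ip Z F ^+ 2 / ip F F.

Lemma minX_le (w : R[i]) :
  minX <= ip (fun x => X x - w * F x) (fun x => X x - w * F x).
Proof.
rewrite ip_sub_X /minX -subr_ge0.
set s := ip X (fun x => ci * F x); set N := ip F F.
have N0 : N != 0 by rewrite gt_eqF.
have -> : ip X X - 2 * complex.Im w * s + cdot w w * N - (ip X X - s ^+ 2 / N) =
   N * (complex.Re w ^+ 2 + (complex.Im w - s / N) ^+ 2) by rewrite /cdot; field.
by rewrite mulr_ge0 ?addr_ge0 ?sqr_ge0// ltW.
Qed.

Lemma minZ_le (w : R[i]) :
  minZ <= ip (fun x => Z x - w * F x) (fun x => Z x - w * F x).
Proof.
rewrite ip_sub_Z /minZ -subr_ge0.
set s := ip Z F; set N := ip F F.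
have N0 : N != 0 by rewrite gt_eqF.
have -> : ip Z Z - 2 * complex.Re w * s + cdot w w * N - (ip Z Z - s ^+ 2 / N) =
   N * (complex.Im w ^+ 2 + (complex.Re w - s / N) ^+ 2) by rewrite /cdot; field.
by rewrite mulr_ge0 ?addr_ge0 ?sqr_ge0// ltW.
Qed.

Lemma minXE : minX = ip (fun x => X x - argX%:C * ci * F x) (fun x => X x - argX%:C * ci * F x).
Proof.
rewrite ip_sub_X /minX /cdot !ReImE /argX; set s := ip X (fun x => ci * F x); set N := ip F F.
have N0 : N != 0 by rewrite gt_eqF.
by field.
Qed.

Lemma minZE : minZ = ip (fun x => Z x - argZ%:C * F x) (fun x => Z x - argZ%:C * F x).
Proof.
rewrite ip_sub_Z /minZ /cdot !ReImE /argZ; set s := ip Z F; set N := ip F F.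
have N0 : N != 0 by rewrite gt_eqF.
by field.
Qed.

Definition comb (t s : R) x := t%:C * (X x - argX%:C * ci * F x) + s%:C * (Z x - argZ%:C * F x).

Let ip_comb t s : ip (comb t s) (comb t s) =
  t * t * minX + s * s * minZ - 2 * t * s * ip F F.
Proof.
have h1 : L2 (fun x => X x - argX%:C * ci * F x) by apply: L2B => //; exact: L2Z.
have h2 : L2 (fun x => Z x - argZ%:C * F x) by apply: L2B => //; exact: L2Z.
have h3 := L2Z t%:C h1; have h4 := L2Z s%:C h2.
rewrite /comb ipDl ?ipDr//; last exact: L2D.
rewrite !ipZl// !ipZr// -minXE -minZE [ip _ (fun x => X x - _)]ipC ip_sub_XZ XZ; ring.
Qed.

Lemma minX_ge0 : 0 <= minX. Proof. by rewrite minXE ip_ge0. Qed.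
Lemma minZ_ge0 : 0 <= minZ. Proof. by rewrite minZE ip_ge0. Qed.

(** Cauchy-Schwarz for the two residues, whose inner product is - |F|^2. *)
Lemma ip_le_min : ip F F <= Num.sqrt minX * Num.sqrt minZ.
Proof.
have q t s : 0 <= t * t * minX + s * s * minZ - 2 * t * s * ip F F.
  by rewrite -ip_comb ip_ge0.
(* If minX vanished, q would be affine in t and eventually negative. *)
have P0 : 0 < minX.
  rewrite lt_neqAle minX_ge0 andbT; apply/eqP => e.
  have := q ((minZ + 1) / (2 * ip F F)) 1; rewrite -e.
  have -> : 2 * ((minZ + 1) / (2 * ip F F)) * 1 * ip F F = minZ + 1.
    by field; rewrite gt_eqF.
  lra.
have Q0 : 0 < minZ.
  rewrite lt_neqAle minZ_ge0 andbT; apply/eqP => e.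
  have := q 1 ((minX + 1) / (2 * ip F F)); rewrite -e.
  have -> : 2 * 1 * ((minX + 1) / (2 * ip F F)) * ip F F = minX + 1.
    by field; rewrite gt_eqF.
  lra.
have := q (Num.sqrt minZ) (Num.sqrt minX).
have p2 := sqr_sqrtr minX_ge0; have q2 := sqr_sqrtr minZ_ge0.
have p0 : 0 < Num.sqrt minX by rewrite sqrtr_gt0.
have q0 : 0 < Num.sqrt minZ by rewrite sqrtr_gt0.
set r := Num.sqrt minX in p2 p0 *; set u := Num.sqrt minZ in q2 q0 *.
rewrite -p2 -q2 => H.
have : 0 <= 2 * (r * u) * (r * u - ip F F) by move: H; rewrite !expr2; lra.
by rewrite pmulr_rge0 ?subr_ge0// !mulr_gt0.
Qed.

(** In case of equality the quadratic form ip_comb is degenerate; these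
   coefficients span its kernel. *)
Lemma min_eq : Num.sqrt minX * Num.sqrt minZ = ip F F ->
  ip (comb (Num.sqrt minZ) (Num.sqrt minX)) (comb (Num.sqrt minZ) (Num.sqrt minX)) = 0.
Proof.
rewrite ip_comb => <-.
have := sqr_sqrtr minX_ge0; have := sqr_sqrtr minZ_ge0.
move: (Num.sqrt minX) (Num.sqrt minZ) => r u q2 p2.
have -> : 2 * u * r * (r * u) = 2 * r ^+ 2 * u ^+ 2 by ring.
by rewrite -!expr2 p2 q2; ring.
Qed.

(** Proportionality of the residues gives equality in Cauchy-Schwarz; the sign
   of the factor is forced by ip_sub_XZ and XZ. *)
Lemma min_le_ip (a b c : R) : 0 < c ->
  (forall x, Z x - a%:C * F x = - c%:C * (X x - b%:C * ci * F x)) ->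
  Num.sqrt minX * Num.sqrt minZ <= ip F F.
Proof.
move=> c0 prop.
have h1 : L2 (fun x => X x - b%:C * ci * F x) by apply: L2B => //; exact: L2Z.
set P := ip (fun x => X x - b%:C * ci * F x) (fun x => X x - b%:C * ci * F x).
have E : (fun x => Z x - a%:C * F x) =
    (fun x => (- c)%:C * (X x - b%:C * ci * F x)).
  by apply/funext => x; rewrite prop rmorphN.
have cP : c * P = ip F F.
  by have := ip_sub_XZ a b; rewrite E ipZr// XZ -/P; lra.
have Q : ip (fun x => Z x - a%:C * F x) (fun x => Z x - a%:C * F x) = c ^+ 2 * P.
  by rewrite E ipZl ?ipZr//; [rewrite -/P; ring|exact: L2Z].
have lX : minX <= P by exact: minX_le.
have lZ : minZ <= c ^+ 2 * P by rewrite -Q; exact: minZ_le.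
have P0 : 0 <= P by exact: ip_ge0.
rewrite -cP; apply: (@le_trans _ _ (Num.sqrt P * Num.sqrt (c ^+ 2 * P))).
  by rewrite ler_pM ?sqrtr_ge0// ler_sqrt// mulr_ge0// sqr_ge0.
rewrite sqrtrM ?sqr_ge0// sqrtr_sqr gtr0_norm// mulrCA -expr2 sqr_sqrtr//.
Qed.

End TwoVectors.

(** * The extremal functions *)

Section Gaussians.
Variable R : realType.
Local Notation line := (measurableTypeR R).
Local Notation plane := (line * line)%type.
Local Notation mu := (@lebesgue_measure R).
Local Notation mu2 := (mu \x mu)%E.
Implicit Types (f : R[i] -> R[i]) (A B K z : R[i]).

Lemma cderiv_quadratic A B z v (s : R) :
  cderiv (fun t : R => A * (z + t%:C * v) ^+ 2 + B * (z + t%:C * v)) s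
    (v * (2 * A * (z + s%:C * v) + B)).
Proof.
have d : cderiv (fun t : R => z + t%:C * v) s v.
  apply: cderiv_eq (cderivD (cderiv_cst z s) (cderivM (cderiv_real s) (cderiv_cst v s))) _.
  by cbv beta; ring.
apply: cderiv_eq.
  apply: cderivD; apply: cderivMl; last exact: d.
  exact: (cderivM d d).
by cbv beta; ring.
Qed.

(** The quotient of f by the exponential has derivative 0 along every ray. *)
Lemma linear_ode f A B : entire f ->
  (forall z, derive1 f z = (2 * A * z + B) * f z) ->
  forall z, f z = f 0 * cexp (A * z ^+ 2 + B * z).
Proof.
move=> ef ode z.
pose q (t : R) := A * (0 + t%:C * z) ^+ 2 + B * (0 + t%:C * z).
pose g (t : R) := f (0 + t%:C * z) * cexp (-1 * q t).
have g' t : cderiv g t 0.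
  apply: cderiv_eq.
    apply: cderivM; first exact: cderiv_line.
    apply: cderiv_cexp; apply: cderivMl; exact: cderiv_quadratic.
  by rewrite ode; ring.
have := cderiv0_cst 1 0 g'; rewrite /g /q.
rewrite !add0r mul1r mul0r expr0n/= !mulr0 addr0 mulr0 cexp0 mulr1 => <-.
rewrite mulN1r -mulrA [cexp _ * _]mulrC cexpNK mulr1 //.
Qed.

(** As f is entire, its derivative can be read along the real direction, where
   the exponential is differentiated by real calculus. *)
Lemma gaussian_derive1 f A B K : entire f ->
  (forall z, f z = K * cexp (A * z ^+ 2 + B * z)) ->
  forall z, derive1 f z = (2 * A * z + B) * f z.
Proof.
move=> ef fE z.
have h1 := cderiv_line z 1 0 ef.
have h2 : cderiv (fun t : R => f (z + t%:C * 1)) 0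
    (K * (1 * (2 * A * (z + 0%:C * 1) + B) * cexp (A * (z + 0%:C * 1) ^+ 2 + B * (z + 0%:C * 1)))).
  under eq_fun do rewrite fE.
  by apply: cderivMl; apply: cderiv_cexp; exact: cderiv_quadratic.
have := cderiv_unique h1 h2; rewrite !mul1r mul0r addr0 => ->.
by rewrite fE; ring.
Qed.

(** Half of the rate k absorbs the linear term q x and half of the rest absorbs
   the factor 1 + x^2; normal densities serve as integrable bounds. *)
Lemma gaussian_moment_bound (k q : R) : 0 < k ->
  exists s M : R, 0 <= M /\ forall x : R,
    (1 + x ^+ 2) * expR (- k * x ^+ 2 + q * x) <= M * normal_pdf 0 s x.
Proof.
move=> k0; have kn : k != 0 by rewrite gt_eqF.
have s0 : Num.sqrt (2 / k) != 0 by rewrite gt_eqF// sqrtr_gt0 divr_gt0.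
have pk := normal_peak_gt0 s0; have pkn := lt0r_neq0 pk.
exists (Num.sqrt (2 / k)), ((1 + 4 / k) * expR (q ^+ 2 / (2 * k)) / normal_peak (Num.sqrt (2 / k))).
split.
  apply: divr_ge0; last exact: ltW.
  by apply: mulr_ge0; rewrite ?expR_ge0// addr_ge0// divr_ge0// ltW.
move=> x; rewrite normal_pdfE//= /normal_fun subr0 sqr_sqrtr; last first.
  by rewrite divr_ge0// ltW.
rewrite [leRHS]mulrA divfK//.
have -> : - x ^+ 2 / (2 / k *+ 2) = - (k / 4 * x ^+ 2) by field.
have e1 : 1 + x ^+ 2 <= (1 + 4 / k) * expR (k / 4 * x ^+ 2).
  have h1 : 1 + k / 4 * x ^+ 2 <= expR (k / 4 * x ^+ 2) by exact: expR_ge1Dx.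
  have x0 := sqr_ge0 x.
  have h3 : 0 <= k / 4 * x ^+ 2 by rewrite mulr_ge0// divr_ge0// ltW.
  have h4 : 0 <= 4 / k by rewrite divr_ge0// ltW.
  have h5 : x ^+ 2 = 4 / k * (k / 4 * x ^+ 2) by field.
  have h6 : 4 / k * (k / 4 * x ^+ 2) <= 4 / k * expR (k / 4 * x ^+ 2).
    by rewrite ler_wpM2l//; lra.
  rewrite mulrDl mul1r; lra.
have e2 : expR (- k * x ^+ 2 + q * x) <=
    expR (q ^+ 2 / (2 * k)) * expR (- (k / 2 * x ^+ 2)).
  rewrite -expRD ler_expR -subr_ge0.
  have -> : q ^+ 2 / (2 * k) + - (k / 2 * x ^+ 2) - (- k * x ^+ 2 + q * x) =
    k / 2 * (x - q / k) ^+ 2 by field.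
  by rewrite mulr_ge0 ?sqr_ge0// divr_ge0// ltW.
apply: (le_trans (ler_pM _ _ e1 e2)); rewrite ?expR_ge0//.
  by rewrite addr_ge0// sqr_ge0.
rewrite mulrACA -expRD le_eqVlt; apply/orP; left; apply/eqP.
by congr (_ * expR _); field.
Qed.

(** Writing z = x + iy, the integrand is |z|^2 times a product of gaussians with
   rates 2 / (c + 1) in x and 2 c / (c + 1) in y: both are positive for c > 0. *)
Lemma gaussian_moment_L2 f (c : R) B K : 0 < c -> entire f ->
  (forall z, f z = K * cexp (((c - 1) / (2 * (c + 1)))%:C * z ^+ 2 + B * z)) ->
  L2 mu2 (fock_lift (fun z => z * f z)).
Proof.
move=> c0 ef fE; split.
  by apply: cmeasurable_lift; exact (entireM (@entire_id R) ef).
have c1 : 0 < c + 1 by rewrite addr_gt0.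
have c1n := lt0r_neq0 c1.
have k0 : 0 < 2 / (c + 1) by rewrite divr_gt0.
have l0 : 0 < 2 * c / (c + 1) by rewrite divr_gt0// mulr_gt0.
have [s1 [M1 [M10 b1]]] := gaussian_moment_bound (2 * complex.Re B) k0.
have [s2 [M2 [M20 b2]]] := gaussian_moment_bound (- 2 * complex.Im B) l0.
pose C := Num.sqrt pi^-1 * Num.sqrt pi^-1 * cdot K K * (M1 * M2).
have C0 : 0 <= C by rewrite !mulr_ge0 ?sqrtr_ge0 ?cdot_ge0.
pose n1 := @normal_pdf R 0 s1; pose n2 := @normal_pdf R 0 s2.
have bound p : cdot (fock_lift (fun z => z * f z) p) (fock_lift (fun z => z * f z) p) <=
    C * (n1 p.1 * n2 p.2).
  have -> : cdot (fock_lift (fun z => z * f z) p) (fock_lift (fun z => z * f z) p) =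
    Num.sqrt pi^-1 * Num.sqrt pi^-1 * cdot K K * ((p.1 ^+ 2 + p.2 ^+ 2) *
     (expR (- (2 / (c + 1)) * p.1 ^+ 2 + 2 * complex.Re B * p.1) *
      expR (- (2 * c / (c + 1)) * p.2 ^+ 2 + - 2 * complex.Im B * p.2))).
    rewrite /fock_lift fE (cdotM (weight p)%:C) (cdotM (toC p)) (cdotM K) cdot_cexp.
    have -> : cdot (weight p)%:C (weight p)%:C =
        Num.sqrt pi^-1 * Num.sqrt pi^-1 * expR (- (p.1 ^+ 2 + p.2 ^+ 2)).
      by rewrite /cdot !ReImE /weight mulr0 addr0 mulrACA -expRD; congr (_ * expR _); field.
    have -> : cdot (toC p) (toC p) = p.1 ^+ 2 + p.2 ^+ 2 by rewrite /cdot /toC !ReImE; ring.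
    rewrite -expRD.
    have -> : - (2 / (c + 1)) * p.1 ^+ 2 + 2 * complex.Re B * p.1 +
       (- (2 * c / (c + 1)) * p.2 ^+ 2 + - 2 * complex.Im B * p.2) =
       - (p.1 ^+ 2 + p.2 ^+ 2) +
       2 * complex.Re (((c - 1) / (2 * (c + 1)))%:C * toC p ^+ 2 + B * toC p).
      by rewrite /toC expr2 !ReImE; field.
    by rewrite expRD; ring.
  rewrite /C -[leRHS]mulrA ler_wpM2l ?mulr_ge0 ?sqrtr_ge0 ?cdot_ge0//.
  rewrite mulrACA; apply: (@le_trans _ _
    ((1 + p.1 ^+ 2) * expR (- (2 / (c + 1)) * p.1 ^+ 2 + 2 * complex.Re B * p.1) *
    ((1 + p.2 ^+ 2) * expR (- (2 * c / (c + 1)) * p.2 ^+ 2 + - 2 * complex.Im B * p.2))));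
    last first.
    apply: ler_pM => //; by rewrite mulr_ge0 ?expR_ge0// addr_ge0// sqr_ge0.
  rewrite [leRHS]mulrACA ler_wpM2r ?mulr_ge0 ?expR_ge0//.
  have := sqr_ge0 p.1; have := sqr_ge0 p.2; nra.
have n10 x : 0 <= n1 x by exact: normal_pdf_ge0.
have n20 x : 0 <= n2 x by exact: normal_pdf_ge0.
have mn1 : measurable_fun setT (n1 : line -> R) by exact: measurable_normal_pdf.
have mn2 : measurable_fun setT (n2 : line -> R) by exact: measurable_normal_pdf.
have mn : measurable_fun setT (fun p : plane => (n1 p.1 * n2 p.2)%:E).
  apply/measurable_EFinP; apply: measurable_funM.
    exact: (measurableT_comp mn1 measurable_fst).
  exact: (measurableT_comp mn2 measurable_snd).
have In : (\int[mu2]_p (n1 p.1 * n2 p.2)%:E = 1)%E.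
  have H := fubini_tonelli1 (m1 := mu) (m2 := mu) _ mn (fun p => _).
  rewrite H; last by move=> p; rewrite lee_fin mulr_ge0.
  transitivity (\int[mu]_x (n1 x)%:E)%E; last exact: integral_normal_pdf.
  apply: eq_integral => x _; rewrite /fubini_F/=.
  under eq_integral do rewrite EFinM.
  rewrite ge0_integralZl//.
  - by rewrite [X in (_ * X)%E](integral_normal_pdf 0 s2) mule1.
  - exact/measurable_EFinP.
  - by move=> y _; rewrite lee_fin.
  - by rewrite lee_fin.
apply: (@le_lt_trans _ _ (\int[mu2]_p (C%:E * (n1 p.1 * n2 p.2)%:E))%E).
  apply: ge0_le_integral => //.
  - by move=> p _; rewrite lee_fin cdot_ge0.
  - apply/measurable_EFinP; apply: measurable_cdot;
      by apply: cmeasurable_lift; exact (entireM (@entire_id R) ef).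
  - by apply: emeasurable_funM => //; exact: measurable_cst.
  - by move=> p _; rewrite -EFinM lee_fin.
rewrite ge0_integralZl//.
- by rewrite In mule1 ltry.
- by move=> p _; rewrite lee_fin mulr_ge0.
Qed.

End Gaussians.

(** * Distances in the Fock space *)

Section Uncertainty.
Variable R : realType.
Local Notation line := (measurableTypeR R).
Local Notation plane := (line * line)%type.
Local Notation mu := (@lebesgue_measure R).
Local Notation mu2 := (mu \x mu)%E.
Local Notation ip := (ip mu2).
Local Notation L2 := (L2 mu2).
Implicit Types (f g : R[i] -> R[i]).

Definition derive_subz f : R[i] -> R[i] := fun z => derive1 f z - z * f z.
Definition derive_addz f : R[i] -> R[i] := fun z => derive1 f z + z * f z.

Lemma fock_space_L2 f : fock_space f -> L2 (fock_lift f).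
Proof.
move=> [ef nf]; split; first exact: cmeasurable_lift.
by move: nf; rewrite fock_normE; case: (sqnorm _ _) => //= r _; exact: ltry.
Qed.

Lemma L2_fock_space f : entire f -> L2 (fock_lift f) -> fock_space f.
Proof.
move=> ef hf; split => //.
by rewrite fock_normE (sqnormE hf) ltry.
Qed.

Lemma fock_norm_L2 f : L2 (fock_lift f) ->
  fock_norm f = (Num.sqrt (ip (fock_lift f) (fock_lift f)))%:E.
Proof. by move=> hf; rewrite fock_normE (sqnormE hf). Qed.

Lemma fock_norm_sq f : L2 (fock_lift f) ->
  (fock_norm f ^+ 2 = (ip (fock_lift f) (fock_lift f))%:E)%E.
Proof. by move=> hf; rewrite fock_norm_L2// -EFin_expe sqr_sqrtr// ip_ge0. Qed.

Lemma lift_sub g f (w : R[i]) :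
  fock_lift (fun z => g z - w * f z) = fun p => fock_lift g p - w * fock_lift f p.
Proof. by rewrite liftB liftZ. Qed.

Lemma fock_dist_min g f (m : R) (w0 : R[i]) :
  L2 (fock_lift f) -> L2 (fock_lift g) ->
  (forall w : R[i], m <= ip (fun p => fock_lift g p - w * fock_lift f p)
                     (fun p => fock_lift g p - w * fock_lift f p)) ->
  m = ip (fun p => fock_lift g p - w0 * fock_lift f p)
         (fun p => fock_lift g p - w0 * fock_lift f p) ->
  fock_dist g f = (Num.sqrt m)%:E.
Proof.
move=> hf hg mle mE.
have hw w : L2 (fock_lift (fun z => g z - w * f z)).
  by rewrite lift_sub; apply: L2B => //; exact: L2Z.
apply/eqP; rewrite eq_le; apply/andP; split.
  apply: ereal_inf_lbound; exists w0 => //.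
  by rewrite fock_norm_L2// lift_sub -mE.
apply: le_ereal_inf_tmp => _ [w _ <-].
rewrite fock_norm_L2// lift_sub lee_fin ler_sqrt ?mle//.
exact: ip_ge0.
Qed.

Lemma fock_dist_infty g f : entire f -> entire g -> L2 (fock_lift f) ->
  ~ L2 (fock_lift g) -> fock_dist g f = +oo%E.
Proof.
move=> ef eg hf ng; apply/ereal_inf_pinfty => _ [w _ <-] /=.
have eW : entire (fun z => g z - w * f z).
  exact (entireB eg (entireM (@entire_cst R w) ef)).
apply: contrapT => nW; apply: ng.
have hW : L2 (fock_lift (fun z => g z - w * f z)).
  apply: fock_space_L2; split => //.
  by rewrite ltey; apply/eqP.
have -> : fock_lift g = (fun p => fock_lift (fun z => g z - w * f z) p + w * fock_lift f p).
  by apply/funext => p; rewrite lift_sub subrK.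
by apply: L2D => //; exact: L2Z.
Qed.

Section Domain.
Variable f : R[i] -> R[i].
Hypotheses (ff : fock_space f) (ff' : fock_space (derive1 f))
  (fz : L2 (fock_lift (fun z => z * f z))).
Local Notation F := (fock_lift f).
Local Notation X := (fock_lift (derive_subz f)).
Local Notation Z := (fock_lift (derive_addz f)).

Lemma L2_derive_subz : L2 X.
Proof. by rewrite /derive_subz liftB; apply: L2B => //; exact: fock_space_L2. Qed.

Lemma L2_derive_addz : L2 Z.
Proof. by rewrite /derive_addz liftD; apply: L2D => //; exact: fock_space_L2. Qed.

Lemma fock_generator (a b : R) :
  generator a b F (fun p => a%:C * X p + b%:C * (ci * Z p)).
Proof.
have := generator_lift a b ff.1 ff'.1; congr generator; apply/funext => p.
by rewrite /fock_lift /derive_subz /derive_addz; ring.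
Qed.

Lemma derive_subz_orthogonal : ip X F = 0.
Proof.
apply: (@generator_antisym _ 1 0 F X); [|exact: fock_space_L2|exact: L2_derive_subz].
by have := fock_generator 1 0; congr generator; apply/funext => p; rewrite mul1r mul0r addr0.
Qed.

Lemma derive_addz_orthogonal : ip Z (fun p => ci * F p) = 0.
Proof.
have h : ip (fun p => ci * Z p) F = 0.
  apply: (@generator_antisym _ 0 1 F); [|exact: fock_space_L2|by apply: L2Z; exact: L2_derive_addz].
  by have := fock_generator 0 1; congr generator; apply/funext => p; rewrite mul1r mul0r add0r.
by move: h; rewrite ip_rotl; [lra|exact: L2_derive_addz|exact: fock_space_L2].
Qed.

Lemma derive_subz_addz : ip X Z = - ip F F.
Proof.
have hZ := L2_derive_addz; have hX := L2_derive_subz.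
rewrite -(commutator (fock_space_L2 ff) hX (L2Z ci hZ) fock_generator).
have -> : (fun p => ci * (ci * Z p)) = (fun p => - Z p).
  by apply/funext => p; exact: ciM.
by rewrite ipNr// opprK.
Qed.

Hypothesis F0 : 0 < ip F F.

Lemma dist_productE : dist_product f =
  (Num.sqrt (minX mu2 F X) * Num.sqrt (minZ mu2 F Z))%:E.
Proof.
have hF := fock_space_L2 ff.
rewrite /dist_product asboolT//=.
rewrite (@fock_dist_min (derive_subz f) f (minX mu2 F X) ((argX mu2 F X)%:C * ci)) //; first last.
- exact: (minXE hF L2_derive_subz derive_subz_orthogonal F0).
- exact: (minX_le hF L2_derive_subz derive_subz_orthogonal F0).
- exact: L2_derive_subz.
rewrite (@fock_dist_min (derive_addz f) f (minZ mu2 F Z) (argZ mu2 F Z)%:C) //; first last.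
- exact: (minZE hF L2_derive_addz derive_addz_orthogonal F0).
- exact: (minZ_le hF L2_derive_addz derive_addz_orthogonal F0).
- exact: L2_derive_addz.
Qed.

End Domain.

(** When f' is in the Fock space and z f is not, neither f' - z f - w f nor
   f' + z f - w f is, for any w. *)
Lemma dist_product_infty f : fock_space f -> fock_space (derive1 f) ->
  ~ L2 (fock_lift (fun z => z * f z)) -> dist_product f = +oo%E.
Proof.
move=> ff ff' nz; rewrite /dist_product asboolT//=.
have ez : entire (fun z => z * f z) by exact (entireM (@entire_id R) ff.1).
have hF := fock_space_L2 ff; have hF' := fock_space_L2 ff'.
have -> : fock_dist (fun z => derive1 f z - z * f z) f = +oo%E.
  apply: (fock_dist_infty ff.1 (entireB ff'.1 ez) hF) => hX; apply: nz.
  have -> : fock_lift (fun z => z * f z) =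
      (fun p => fock_lift (derive1 f) p - fock_lift (derive_subz f) p).
    by rewrite /derive_subz liftB; apply/funext => p; rewrite opprB addrC subrK.
  exact: L2B.
have -> : fock_dist (fun z => derive1 f z + z * f z) f = +oo%E.
  apply: (fock_dist_infty ff.1 (entireD ff'.1 ez) hF) => hX; apply: nz.
  have -> : fock_lift (fun z => z * f z) =
      (fun p => fock_lift (derive_addz f) p - fock_lift (derive1 f) p).
    by rewrite /derive_addz liftD; apply/funext => p; rewrite addrC addKr.
  exact: L2B.
by [].
Qed.

End Uncertainty.

(** Read with d = f'(z) and w = f(z): proportionality of the residues is the
   differential equation of the extremal functions. *)
Lemma proportional_ode (R : realType) (c a b : R) (d z w : R[i]) : 0 < c ->
  d + z * w - a%:C * w = - c%:C * (d - z * w - b%:C * ci * w) <->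
  d = (2 * ((c - 1) / (2 * (c + 1)))%:C * z + (a +i* (b * c)) / (c + 1)%:C) * w.
Proof.
move=> c0; have c1 : c + 1 != 0 by rewrite gt_eqF// addr_gt0.
have C1 : c%:C + 1 != 0 :> R[i].
  apply: contra c1 => /eqP/(congr1 (@complex.Re R)); rewrite !ReImE => /eqP.
  by [].
have -> : 2 * ((c - 1) / (2 * (c + 1)))%:C = (c%:C - 1) / (c%:C + 1) :> R[i].
  apply: (mulIf C1); rewrite divfK//.
  by apply: complex_ext; rewrite mulr2n mulrDl mul1r !ReImE; field.
rewrite mkC rmorphM (rmorphD _ c 1) rmorph1; split => [H|->]; last by field.
apply: (mulIf C1).
have -> : d * (c%:C + 1) = (d + z * w - a%:C * w) + c%:C * (d - z * w - b%:C * ci * w)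
   + ((c%:C - 1) * z + (a%:C + b%:C * c%:C * ci)) * w by ring.
by rewrite H; field.
Qed.

(** * The uncertainty inequality and its equality case *)

Section Main.
Variables (R : realType) (f : R[i] -> R[i]).
Hypotheses (ff : fock_space f) (f0 : ~ (forall z : R[i], f z = 0)).
Local Notation mu2 := ((@lebesgue_measure R) \x (@lebesgue_measure R))%E.
Local Notation F := (fock_lift f).

Lemma fock_norm_pos : 0 < ip mu2 F F.
Proof.
have hF := fock_space_L2 ff.
rewrite lt_neqAle ip_ge0 andbT eq_sym; apply/eqP => e; apply: f0.
by apply: (lift_ae0 ff.1); rewrite (sqnormE hF) e.
Qed.

Lemma fock_uncertainty : (fock_norm f ^+ 2 <= dist_product f)%E.
Proof.
have hF := fock_space_L2 ff.
have [ff'|nf'] := pselect (fock_space (derive1 f)); last first.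
  by rewrite /dist_product asboolF// leey.
have [fz|nz] := pselect (L2 mu2 (fock_lift (fun z => z * f z))); last first.
  by rewrite dist_product_infty// leey.
rewrite fock_norm_sq// dist_productE ?fock_norm_pos// lee_fin.
apply: ip_le_min => //; [exact: L2_derive_subz|exact: L2_derive_addz|exact: derive_subz_orthogonal
  |exact: derive_addz_orthogonal|exact: derive_subz_addz|exact: fock_norm_pos].
Qed.

Lemma fock_equality : dist_product f = (fock_norm f ^+ 2)%E ->
  exists (c a b : R), 0 < c /\ forall z,
    derive1 f z = (2 * ((c - 1) / (2 * (c + 1)))%:C * z + (a +i* (b * c)) / (c + 1)%:C) * f z.
Proof.
have hF := fock_space_L2 ff; have N0 := fock_norm_pos.
have [ff'|nf'] := pselect (fock_space (derive1 f)); last first.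
  by rewrite /dist_product asboolF// fock_norm_sq.
have [fz|nz] := pselect (L2 mu2 (fock_lift (fun z => z * f z))); last first.
  by rewrite dist_product_infty// fock_norm_sq.
rewrite fock_norm_sq// dist_productE// => -[PQ].
have hX := L2_derive_subz ff' fz; have hZ := L2_derive_addz ff' fz.
have oX := derive_subz_orthogonal ff ff' fz; have oZ := derive_addz_orthogonal ff ff' fz.
have XZ := derive_subz_addz ff ff' fz.
have := min_eq hF hX hZ oX oZ XZ N0 PQ.
have := PQ; move: (sqrtr_ge0 (minX mu2 F (fock_lift (derive_subz f)))).
move: (sqrtr_ge0 (minZ mu2 F (fock_lift (derive_addz f)))).
pose a := argZ mu2 F (fock_lift (derive_addz f)).
pose b := argX mu2 F (fock_lift (derive_subz f)).
set r := Num.sqrt (minX _ _ _); set u := Num.sqrt (minZ _ _ _) => u0 r0 ru.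
have rp : 0 < r.
  rewrite lt_neqAle r0 andbT; apply/eqP => e.
  by move: N0; rewrite -ru -e mul0r ltxx.
have up : 0 < u.
  rewrite lt_neqAle u0 andbT; apply/eqP => e.
  by move: N0; rewrite -ru -e mulr0 ltxx.
(* Equality in Cauchy-Schwarz makes the combination h of the residues vanish. *)
pose h z := u%:C * (derive_subz f z - b%:C * ci * f z) + r%:C * (derive_addz f z - a%:C * f z).
have -> : comb mu2 F (fock_lift (derive_subz f)) (fock_lift (derive_addz f)) u r = fock_lift h.
  by apply/funext => p; rewrite /comb /fock_lift /h -/a -/b; ring.
move=> h0.
have ez : entire (fun z => z * f z) by exact (entireM (@entire_id R) ff.1).
have cst (w : R[i]) g : entire g -> entire (fun z => w * g z).
  by move=> eg; exact (entireM (@entire_cst R w) eg).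
have eh : entire h.
  exact (entireD (cst u%:C _ (entireB (entireB ff'.1 ez) (cst (b%:C * ci) _ ff.1)))
    (cst r%:C _ (entireB (entireD ff'.1 ez) (cst a%:C _ ff.1)))).
have hL : L2 mu2 (fock_lift h).
  have -> : fock_lift h = fun p => u%:C * (fock_lift (derive_subz f) p - b%:C * ci * F p) +
      r%:C * (fock_lift (derive_addz f) p - a%:C * F p).
    by apply/funext => p; rewrite /fock_lift /h; ring.
  by apply: L2D; apply: L2Z; apply: L2B; [exact: hX|exact: L2Z|exact: hZ|exact: L2Z].
have hz : forall z, h z = 0 by apply: (lift_ae0 eh); rewrite (sqnormE hL) h0.
exists (u / r), a, b; split; first exact: divr_gt0.
have rn : r%:C != 0 :> R[i].
  by apply: contra (lt0r_neq0 rp) => /eqP/(congr1 (@complex.Re R))/= ->.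
move=> z; apply/proportional_ode; first exact: divr_gt0.
have := hz z; rewrite /h /derive_subz /derive_addz => E.
have cE : (u / r)%:C = u%:C / r%:C :> R[i] by rewrite rmorphM fmorphV.
apply: (mulIf rn); rewrite cE.
have -> : (- (u%:C / r%:C) * (derive1 f z - z * f z - b%:C * ci * f z)) * r%:C =
  r%:C * (derive1 f z + z * f z - a%:C * f z) -
  (u%:C * (derive1 f z - z * f z - b%:C * ci * f z) + r%:C * (derive1 f z + z * f z - a%:C * f z)).
  by field.
by rewrite E subr0 mulrC.
Qed.

Lemma fock_gaussian (c a b : R) (K : R[i]) : 0 < c ->
  (forall z : R[i], f z = K * cexp (((c - 1) / (2 * (c + 1)))%:C * z ^+ 2
                       + (a +i* (b * c)) / (c + 1)%:C * z)) ->
  dist_product f = (fock_norm f ^+ 2)%E.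
Proof.
move=> c0 fE; have hF := fock_space_L2 ff; have N0 := fock_norm_pos.
have fz := gaussian_moment_L2 c0 ff.1 fE.
have f'E := gaussian_derive1 ff.1 fE.
set A := ((c - 1) / (2 * (c + 1)))%:C in fE f'E; set B := (a +i* (b * c)) / _ in fE f'E.
have ez : entire (fun z => z * f z) by exact (entireM (@entire_id R) ff.1).
have d1E : derive1 f = (fun z => 2 * A * (z * f z) + B * f z).
  by apply/funext => z; rewrite f'E mulrDl mulrA.
have ff' : fock_space (derive1 f).
  apply: L2_fock_space; rewrite d1E.
    exact (entireD (entireM (@entire_cst R (2 * A)) ez) (entireM (@entire_cst R B) ff.1)).
  by rewrite liftD !liftZ; apply: L2D; exact: L2Z.
apply/eqP; rewrite eq_le fock_uncertainty andbT.
rewrite dist_productE// fock_norm_sq// lee_fin.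
have hX := L2_derive_subz ff' fz; have hZ := L2_derive_addz ff' fz.
have oX := derive_subz_orthogonal ff ff' fz; have oZ := derive_addz_orthogonal ff ff' fz.
have XZ := derive_subz_addz ff ff' fz.
apply: (min_le_ip hF hX hZ oX oZ XZ N0 (a := a) (b := b) c0) => p.
have := (proportional_ode a b _ _ _ c0).2 (f'E (toC p)).
rewrite /fock_lift /derive_subz /derive_addz => E.
transitivity ((weight p)%:C * (derive1 f (toC p) + toC p * f (toC p) - a%:C * f (toC p))).
  by ring.
by rewrite E; ring.
Qed.

End Main.

Theorem corollary10 (R : realType) (f : R[i] -> R[i])
    (hf : fock_space f) (hf0 : ~ (forall z : R[i], f z = 0)) :
  (fock_norm f ^+ 2 <= dist_product f)%E /\
  (dist_product f = (fock_norm f ^+ 2)%E <->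
   exists (c a b : R) (K : R[i]), [/\ 0 < c, K != 0 &
     forall z : R[i],
       f z = K * cexp (((c - 1) / (2 * (c + 1)))%:C * z ^+ 2
                       + (a +i* (b * c)) / (c + 1)%:C * z)]).
Proof.
split; first exact: fock_uncertainty.
split=> [/(fock_equality hf hf0)[c [a [b [c0 ode]]]]|[c [a [b [K [c0 _ fE]]]]]]; last first.
  exact (fock_gaussian hf hf0 c0 fE).
have fE := linear_ode hf.1 ode.
exists c, a, b, (f 0); split => //; apply/eqP => K0; apply: hf0 => z.
by rewrite fE K0 mul0r.
Qed.
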